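(* Let $K$ be an abelian (i.e. cyclic Galois) cubic number field which is tamely ramified over $\mathbb Q$, and let $D_K$ be its discriminant. Let $F_K$ be the set of polynomials of the form $f = t^3 - t^2 + a t + b \in \mathbb Z[t]$ whose root field is isomorphic to $K$. For every such $f$ one has $a \le 0$; put $H(f) = \sqrt{1-3a}$. Then, as an identity of Dirichlet series (equivalently, for all complex $s$ with $\operatorname{Re}(s) > 1$, where both sides converge absolutely), $$\sqrt{D_K}^{\,s} \sum_{f \in F_K} H(f)^{-2s} = (1 - 3^{-s})\,\zeta_{\mathbb Q(\sqrt{-3})}(s),$$ where $\zeta_{\mathbb Q(\sqrt{-3})}$ is the Dedekind zeta function of $\mathbb Q(\sqrt{-3})$.
   Context: An abelian cubic number field is a number field $K$ with $[K:\mathbb Q]=3$ that is Galois over $\mathbb Q$ (with Galois group $\mathbb Z/3\mathbb Z$). Tamely ramified means that no prime is wildly ramified in $K$ (for such $K$, equivalently, $3$ is unramified in $K$). The root field of a polynomial $f\in\mathbb Z[t]$ whose root field is isomorphic to $K$ means: $f$ is irreducible over $\mathbb Q$ and $\mathbb Q[t]/(f) \cong K$ (equivalently $\mathbb Q(\alpha)\cong K$ for a root $\alpha$ of $f$). The Dedekind zeta function is $\zeta_{\mathbb Q(\sqrt{-3})}(s) = \sum_{\mathfrak a} N(\mathfrak a)^{-s}$, the sum over nonzero ideals $\mathfrak a$ of the ring of integers $\mathbb Z[(1+\sqrt{-3})/2]$. *)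

(* Defs.v *)
From HB Require Import structures.
From mathcomp Require Import all_boot all_order all_algebra all_fingroup all_field.
From mathcomp Require Import finmap complex.
From mathcomp Require Import all_classical all_reals all_analysis.
From mathcomp.analysis.showcase Require summability.
Set Implicit Arguments.
Unset Strict Implicit.
Unset Printing Implicit Defensive.
Import Order.TTheory GRing.Theory Num.Theory.
Import numFieldNormedType.Exports.
Local Open Scope classical_set_scope.
Local Open Scope ring_scope.

Section NumberField.
Variable L : fieldExtType rat.

Definition ring_of_integers : set L := [set x | integralOver (intr : int -> L) x].

(* Ideals of the ring of integers, as subsets of L. *)
Definition is_ideal (I : set L) : Prop :=
  [/\ I `<=` ring_of_integers, I 0,
      forall x y, I x -> I y -> I (x + y)
    & forall a x, ring_of_integers a -> I x -> I (a * x)].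

Definition is_prime_ideal (P : set L) : Prop :=
  [/\ is_ideal P, ~ P 1
    & forall x y, ring_of_integers x -> ring_of_integers y ->
        P (x * y) -> P x \/ P y].

Definition ideal_mul (I J : set L) : set L :=
  [set x | exists s : seq (L * L),
     (forall u, u \in s -> I u.1 /\ J u.2) /\ x = \sum_(u <- s) u.1 * u.2].

Definition ideal_exp (I : set L) (n : nat) : set L :=
  iter n (ideal_mul I) ring_of_integers.

Definition principal_ideal (a : L) : set L :=
  [set a * x | x in ring_of_integers].

(* e is the exponent of P in the factorization of p O_L, i.e. the largest
   e such that P ^ e divides (equivalently, contains) p O_L. *)
Definition is_ramification_index (p : nat) (P : set L) (e : nat) : Prop :=
  principal_ideal p%:R `<=` ideal_exp P e /\
  ~ (principal_ideal p%:R `<=` ideal_exp P e.+1).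

(* Residue fields are finite, hence perfect: wild ramification at P only means
   that the residue characteristic divides the ramification index. *)
Definition tamely_ramified : Prop :=
  forall (p : nat) (P : set L) (e : nat), prime p -> is_prime_ideal P -> P p%:R ->
    is_ramification_index p P e -> ~~ (p %| e)%N.

Definition nonzero_ideals : set (set L) :=
  [set I | is_ideal I /\ I != [set 0]].

(* The number of cosets of I in the ring of integers. *)
Definition ideal_norm (I : set L) : nat :=
  #|` fset_set [set [set x + y | y in I] | x in ring_of_integers] |.

End NumberField.

Section Discriminant.
(* A splitting field over rat, i.e. a Galois number field, so that galTrace is
   the trace from K to the rationals. *)
Variable K : splittingFieldType rat.

Definition integral_basis (e : (\dim {:K}).-tuple K) : Prop :=
  basis_of {:K} e /\
  @ring_of_integers K =
    [set x | exists c : 'I_(\dim {:K}) -> int, x = \sum_i (tnth e i) *~ c i].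

Definition is_discriminant (d : int) : Prop :=
  exists2 e : (\dim {:K}).-tuple K, integral_basis e &
    d%:~R = \det (\matrix_(i, j) galTrace 1 {:K} (tnth e i * tnth e j)).

Definition discriminant : int := xget 0 is_discriminant.

Definition abelian_cubic : Prop :=
  \dim {:K} = 3 /\ galois 1 {:K}.

End Discriminant.

(* {poly %/ p} is the quotient by p only when p is monic of positive degree; this
   is the case for the cubics to which the definition is applied below. *)
Definition has_root_field (L : fieldExtType rat) (f : {poly int}) : Prop :=
  let fQ : {poly rat} := map_poly intr f in
  irreducible_poly fQ /\
  exists phi : {rmorphism {poly %/ fQ} -> L}, bijective phi.

Definition trace_one_cubics (L : fieldExtType rat) : set {poly int} :=
  [set f | (exists a b : int, f = 'X^3 - 'X^2 + a *: 'X + b%:P) /\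
           has_root_field L f].

(* num_field_exists s provides the subfield of algC generated by s. *)
Definition Qsqrtm3 : fieldExtType rat := tag (num_field_exists [:: sqrtC (-3)]).

Section Analytic.
Variable R : realType.

(* x ^ s = exp (s ln x), for real x > 0 and complex s. *)
Definition cpow (x : R) (s : R[i]) : R[i] :=
  (expR (complex.Re s * ln x))%:C%C *
  (cos (complex.Im s * ln x) +i* sin (complex.Im s * ln x))%C.

Definition abs_summable (T : choiceType) (D : set T) (f : T -> R[i]) : Prop :=
  summable D (fun x => (complex.Re `|f x|)%:E).

(* The unordered sum of the f x for x in D: the limit of the sums over the
   finite subsets of D. *)
Definition csum (T : choiceType) (D : set T) (f : T -> R[i]) : R[i] :=
  @summability.sum T R[i] R[i]^o (patch (fun=> 0) D f).

(* H f depends on the coefficient a of 'X in f = 'X^3 - 'X^2 + a *: 'X + b%:P. *)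
Definition H (f : {poly int}) : R := Num.sqrt (1 - 3 * (f`_1)%:~R).

Definition dedekind_term (L : fieldExtType rat) (s : R[i]) (I : set L) : R[i] :=
  cpow (ideal_norm I)%:R (- s).

Definition dedekind_zeta (L : fieldExtType rat) (s : R[i]) : R[i] :=
  csum (@nonzero_ideals L) (dedekind_term s).

End Analytic.

(* Main.v *)
From HB Require Import structures.
Require Import Defs.
From mathcomp Require Import all_boot all_order all_algebra all_fingroup all_field.
From mathcomp Require Import finmap complex.
From mathcomp Require Import all_classical all_reals all_analysis.
From mathcomp Require Import cyclic.
From mathcomp Require Import ring lra zify.
From mathcomp.analysis.showcase Require summability.
Set Implicit Arguments.
Unset Strict Implicit.
Unset Printing Implicit Defensive.
Import Order.TTheory GRing.Theory Num.Theory.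
Import numFieldNormedType.Exports.
Local Open Scope classical_set_scope.
Local Open Scope ring_scope.

(** Tameness forces the trace of the integers O_K onto Z: otherwise 3 divides
    every trace, cubing is the norm modulo 3 O_K, and the elements whose norm
    is divisible by 3 form a prime P with ramification index 3.  Let s generate
    the Galois group.  The trace-zero integers form a module over Z[omega]
    (omega acting as s) on which x^2 + x s(x) + s(x)^2 is a positive definite
    norm form, so the Euclidean algorithm yields a generator m; by surjectivity
    of the trace m can be chosen of the form s(b) - b with b of trace 1.  Then
    b, m, s(m) is an integral basis, D_K = N^2 where N is the value of the form
    at m, and x |-> s(x) - x identifies the integers of trace 1 with the
    (u + v omega) m, u + v = 1 mod 3.  If f is the characteristic polynomial of
    x, then H(f)^2 is the form at s(x) - x, i.e. N times the norm of
    u + v omega.  Conjugation of x is multiplication by omega, and every ideal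
    of Z[omega] prime to sqrt(-3) has exactly three generators u + v omega with
    u + v = 1 mod 3, so the left-hand side is the sum over the ideals prime to
    sqrt(-3); the other ideals contribute 3^(-s) zeta(s). *)

(** * Modules over the Eisenstein integers *)

(** The wild case is settled by elementary means, without unique factorization of ideals. A local
    generator of P is replaced by a pair w, p with p in P, w outside P and w P contained in p O_K.
    It turns membership of 3 in P^e into an equation w^e 3 = p^e r, whose norm is an equation
    between rational integers. Norms exclude maximal exponent 2 and membership in P^4, but not
    maximal exponent 1; there the choice of m as a generator of the trace-zero integers decides.

    For an integer x of trace 1 write s(x) - x = (u + v omega) m. Adding (c + d omega) m to x adds
    (omega - 1)(c + d omega) to u + v omega, so u + v modulo 3 is the only invariant. It is not 0,
    since otherwise x could be moved to a rational integer, whose trace is divisible by 3. Hence u +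
    v omega can be moved to 1 or -1, and the sign is absorbed in m.

    Convergence comes from choosing for each ideal a generator with nonnegative coordinates: the
    norm then dominates a product of two linear factors, and the double series splits. *)

Definition eis_norm (R : pzRingType) (a b : R) : R := a ^+ 2 - a * b + b ^+ 2.

(** Rounding leaves errors of absolute value at most 1/2 in both coordinates, and there x^2 - x y +
    y^2 is at most 3/4. *)
Lemma eis_norm_round (a b : rat) :
  exists c d : int, eis_norm (a - c%:~R) (b - d%:~R) < 1.
Proof.
have rnd (x : rat) : exists c : int, `|x - c%:~R| <= 2^-1.
  exists (Num.floor (x + 2^-1)); rewrite ler_norml.
  have := floor_itv (x + 2^-1); rewrite intrD => /andP[h1 h2].
  by apply/andP; split; lra.
have [[c hc] [d hd]] := (rnd a, rnd b); exists c, d.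
move: hc hd; rewrite /eis_norm !ler_norml.
set x := a - _; set y := b - _ => /andP[h1 h2] /andP[h3 h4].
nra.
Qed.

(** Euclidean division by a nonzero [m] with least value of [Q]: rounding the rational coordinates
    of [x] leaves a remainder of smaller value, hence zero. The map [w] plays multiplication by
    omega. The lemma serves twice, for the trace-zero integers with [w] the Galois generator and for
    the ideals of Z[omega]. *)
Lemma eis_module_cyclic (V : lmodType rat) (w : V -> V) (M : set V) (Q : V -> rat) :
    (forall x y, M x -> M y -> M (x - y)) -> (forall x, M x -> M (w x)) ->
    (forall m (a b : rat), M m ->
       Q (a *: m + b *: w m) = eis_norm a b * Q m) ->
    (forall x, M x -> exists n : nat, Q x = n%:R) ->
    (forall x, M x -> x != 0 -> Q x != 0) ->
    (forall m x, M m -> m != 0 -> M x ->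
       exists a b : rat, x = a *: m + b *: w m) ->
    (exists2 x, M x & x != 0) ->
  exists m, [/\ M m, m != 0 &
    forall x, M x -> exists a b : int, x = m *~ a + w m *~ b].
Proof.
move=> MB Mw QE Qnat Q0 dep [x0 Mx0 x0N0].
have M0 : M 0 by rewrite -(subrr x0); exact: MB.
have MN x : M x -> M (- x) by rewrite -(sub0r x); exact: MB.
have MD x y : M x -> M y -> M (x + y).
  by move=> Mx My; rewrite -[y]opprK; apply: MB => //; apply: MN.
have Mn x n : M x -> M (x *+ n).
  by move=> Mx; elim: n => [|n IHn]; rewrite ?mulr0n// mulrS; apply: MD.
have Mz x (n : int) : M x -> M (x *~ n).
  by case: n => n Mx; rewrite ?NegzE ?mulrNz -pmulrn; [|apply: MN]; apply: Mn.
pose P n := `[< exists m, [/\ M m, m != 0 & Q m = n%:R] >].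
have exP : exists n, P n.
  by have [n Qn] := Qnat _ Mx0; exists n; apply/asboolP; exists x0.
have [n /asboolP[m [Mm mN0 Qm]] nmin] := ex_minnP exP.
exists m; split=> // x Mx; have [a [b xE]] := dep _ _ Mm mN0 Mx.
have [c [d lt1]] := eis_norm_round a b.
exists c, d; apply/eqP; rewrite -subr_eq0; apply/negP => /negP rN0.
set r := x - _ in rN0.
have Mr : M r by apply: MB => //; apply: MD; apply: Mz => //; apply: Mw.
have rE : r = (a - c%:~R) *: m + (b - d%:~R) *: w m.
  by rewrite /r xE !scalerBl -!scaler_int opprD addrACA.
have [k Qr] := Qnat _ Mr.
have /nmin : P k by apply/asboolP; exists r.
suff : Q r < Q m by rewrite Qr Qm ltr_nat => h /(leq_ltn_trans)/(_ h); rewrite ltnn.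
have Qm0 : 0 < Q m by rewrite lt_neqAle eq_sym Q0// Qm ler0n.
by rewrite rE QE// -[ltRHS]mul1r ltr_pM2r.
Qed.

(** * Cyclic cubic fields *)

Lemma in_alg_int (L : fieldExtType rat) (n : int) : (n%:~R)%:A = n%:~R :> L.
Proof. by rewrite -in_algE rmorph_int. Qed.

Lemma in_alg_inj (L : fieldExtType rat) (p q : rat) : p%:A = q%:A :> L -> p = q.
Proof. by rewrite -!in_algE => /fmorph_inj. Qed.

Lemma intr_ext_inj (L : fieldExtType rat) (a b : int) : a%:~R = b%:~R :> L -> a = b.
Proof. by rewrite -!in_alg_int => /in_alg_inj/intr_inj. Qed.

Lemma integral_rat_int (L : fieldExtType rat) (q : rat) :
  ring_of_integers (q%:A : L) -> exists n : int, q = n%:~R.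
Proof.
case=> p p_mon; rewrite /root.
have -> : map_poly (intr : int -> L) p = map_poly (in_alg L) (map_poly intr p).
  by rewrite -map_poly_comp; apply: eq_map_poly => n /=; rewrite in_alg_int.
rewrite -in_algE horner_map fmorph_eq0 => rt.
have /intrP[n nE] : (ratr q : algC) \in Num.int.
  apply: Cint_rat_Aint; first exact: Crat_rat.
  apply: (@root_monic_Aint (map_poly intr p)).
  - have -> : map_poly (intr : int -> algC) p = map_poly ratr (map_poly (intr : int -> rat) p).
      by rewrite -map_poly_comp; apply: eq_map_poly => k /=; rewrite ratr_int.
    by rewrite /root horner_map fmorph_eq0.
  - exact: monic_map.
  - by apply/polyOverP => i; rewrite coef_map /= intr_int.
by exists n; apply: (fmorph_inj (@ratr algC)); rewrite /= nE ratr_int.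
Qed.

Section RingOfIntegers.
Variable L : fieldExtType rat.
Implicit Types x y : L.
Local Notation O := (@ring_of_integers L).

Lemma integersD x y : O x -> O y -> O (x + y). Proof. exact: integral_add. Qed.
Lemma integersB x y : O x -> O y -> O (x - y). Proof. exact: integral_sub. Qed.
Lemma integersM x y : O x -> O y -> O (x * y). Proof. exact: integral_mul. Qed.
Lemma integersN x : O x -> O (- x). Proof. exact: integral_opp. Qed.
Lemma integers0 : O 0. Proof. exact: (mxpoly.integral0 intr). Qed.
Lemma integers1 : O 1. Proof. exact: (mxpoly.integral1 intr). Qed.
Lemma integers_int (n : int) : O n%:~R. Proof. exact: (integral_id intr). Qed.
Lemma integers_nat (n : nat) : O n%:R. Proof. exact: (integral_nat intr). Qed.
Lemma integersX x n : O x -> O (x ^+ n).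
Proof. by move=> Ox; elim: n => [|n IHn]; rewrite ?exprS; [exact: integers1|exact: integersM]. Qed.
Lemma integersMz x (n : int) : O x -> O (x *~ n).
Proof. by move=> Ox; rewrite -mulrzr; apply: integersM => //; apply: integers_int. Qed.
Lemma integers_rmorph (s : {rmorphism L -> L}) x : O x -> O (s x).
Proof.
case=> p p_mon rt; exists p => //; move: rt => /(rmorph_root s).
rewrite -map_poly_comp; congr root.
by apply: eq_map_poly => n /=; rewrite rmorph_int.
Qed.

End RingOfIntegers.

Section CyclicCubic.
Variables (K : fieldExtType rat) (s : {rmorphism K -> K}).
Hypothesis s3 : forall x, s (s (s x)) = x.
Hypothesis sfix : forall x, s x = x -> exists q : rat, x = q%:A.
Implicit Types x y z m : K.
Local Notation O := (@ring_of_integers K).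

Definition conj_trace x := x + s x + s (s x).
Definition conj_e2 x := x * s x + s x * s (s x) + s (s x) * x.
Definition conj_norm x := x * s x * s (s x).
(** On elements of trace zero this is [- conj_e2 x], that is, half the trace of x^2. *)
Definition conj_form x := x ^+ 2 + x * s x + (s x) ^+ 2.

Local Notation tr := conj_trace.
Local Notation e2 := conj_e2.
Local Notation nm := conj_norm.
Local Notation qf := conj_form.

Lemma s_tr x : s (tr x) = tr x.
Proof. by rewrite /conj_trace !rmorphD/= s3; ring. Qed.
Lemma s_e2 x : s (e2 x) = e2 x.
Proof. by rewrite /conj_e2 !rmorphD/= !rmorphM/= s3; ring. Qed.
Lemma s_nm x : s (nm x) = nm x.
Proof. by rewrite /conj_norm !rmorphM/= s3; ring. Qed.

Lemma tr_s x : tr (s x) = tr x.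
Proof. by rewrite /conj_trace s3; ring. Qed.
Lemma trD x y : tr (x + y) = tr x + tr y.
Proof. by rewrite /conj_trace !rmorphD/=; ring. Qed.
Lemma trB x y : tr (x - y) = tr x - tr y.
Proof. by rewrite /conj_trace !rmorphB/=; ring. Qed.
Lemma trMz x (n : int) : tr (x *~ n) = tr x *~ n.
Proof. by rewrite /conj_trace !rmorphMz/= !mulrzDl. Qed.
Lemma nmM x y : nm (x * y) = nm x * nm y.
Proof. by rewrite /conj_norm !rmorphM/=; ring. Qed.
Lemma nm_int (n : int) : nm n%:~R = (n ^+ 3)%:~R.
Proof. by rewrite /conj_norm !rmorph_int rmorphXn/=; ring. Qed.

Lemma fixed_int x : O x -> s x = x -> exists n : int, x = n%:~R.
Proof.
move=> Ox /sfix[q xE]; move: Ox; rewrite xE => /integral_rat_int[n ->].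
by exists n; rewrite in_alg_int.
Qed.

Lemma integers_conj x : O x -> O (s x). Proof. exact: integers_rmorph. Qed.

Lemma tr_int x : O x -> exists n : int, tr x = n%:~R.
Proof.
move=> Ox; apply: fixed_int (s_tr x).
by rewrite /conj_trace; do !apply: integersD => //; do ?apply: integers_conj.
Qed.
Lemma e2_int x : O x -> exists n : int, e2 x = n%:~R.
Proof.
move=> Ox; apply: fixed_int (s_e2 x).
by rewrite /conj_e2; do !apply: integersD => //; apply: integersM; do ?apply: integers_conj.
Qed.
Lemma nm_O_int x : O x -> exists n : int, nm x = n%:~R.
Proof.
move=> Ox; apply: fixed_int (s_nm x).
by rewrite /conj_norm; apply: integersM; first apply: integersM; do ?apply: integers_conj.
Qed.

Lemma charpolyE x :
  x ^+ 3 - tr x * x ^+ 2 + e2 x * x - nm x = 0.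
Proof. by rewrite /conj_trace /conj_e2 /conj_norm; ring. Qed.

Lemma integral_cubic x (a b c : int) :
  x ^+ 3 - a%:~R * x ^+ 2 + b%:~R * x - c%:~R = 0 -> O x.
Proof.
move=> xE; apply: (@integral_root_monic _ _ _ _
   ('X^3 - (a%:~R *: 'X^2 - b%:~R *: 'X + c%:~R%:P))).
- rewrite monicE lead_coefDl ?lead_coefXn// size_polyXn size_polyN.
  apply: leq_ltn_trans (size_polyD _ _) _; rewrite gtn_max; apply/andP; split.
    apply: leq_ltn_trans (size_polyD _ _) _; rewrite size_polyN gtn_max.
    by rewrite !(leq_ltn_trans (size_scale_leq _ _)) ?size_polyXn ?size_polyX.
  by rewrite (leq_ltn_trans (size_polyC_leq1 _)).
- rewrite /root !(hornerD, hornerN, hornerZ, hornerXn, hornerX, hornerC).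
  by apply/eqP; rewrite -[RHS]xE; ring.
- apply/integral_poly => i.
  rewrite !(coefD, coefN, coefZ, coefXn, coefX, coefC).
  apply: integersB; first exact: integers_nat.
  apply: integersD; first by apply: integersB; apply: integersM; do ?exact: integers_nat; exact: integers_int.
  by case: ifP => _; [exact: integers_int|exact: integers0].
Qed.

Lemma integral_charpoly x (a b c : int) :
  tr x = a%:~R -> e2 x = b%:~R -> nm x = c%:~R -> O x.
Proof.
by move=> ta eb nc; apply: (@integral_cubic x a b c); rewrite -ta -eb -nc charpolyE.
Qed.

Lemma s_neq x : s x != x -> s (s x) != x /\ s (s x) != s x.
Proof.
move=> sx; split; apply: contra sx => /eqP h; apply/eqP.
  by rewrite -{2}(s3 x) h.
by have := s3 x; rewrite h h.
Qed.

Lemma tr0_ss x : tr x = 0 -> s (s x) = - x - s x.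
Proof.
rewrite /conj_trace => h; have -> : s (s x) = x + s x + s (s x) - x - s x by ring.
by rewrite h sub0r.
Qed.

Lemma s_qf x : tr x = 0 -> s (qf x) = qf x.
Proof.
by move=> t0; rewrite /conj_form !rmorphD/= !rmorphXn/= rmorphM/= tr0_ss//; ring.
Qed.


Lemma alg_natrN0 (n : nat) : n.+1%:R != 0 :> K.
Proof. by have := pnatr_eq0 rat n.+1; rewrite -(rmorph_nat (in_alg K)) fmorph_eq0 => ->. Qed.

(** A cyclic permutation of the three conjugates is even, so the product of their differences is
    fixed by [s] and therefore rational. *)
Lemma disc_square x : s x != x ->
  exists2 q : rat, q != 0 &
    (q ^+ 2)%:A = (x - s x) ^+ 2 * (s x - s (s x)) ^+ 2 * (s (s x) - x) ^+ 2.
Proof.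
move=> sx; have [sx2 sx3] := s_neq sx.
pose d := (x - s x) * (s x - s (s x)) * (s (s x) - x).
have sd : s d = d by rewrite /d !rmorphM/= !rmorphB/= s3; ring.
have [q dq] := sfix sd.
exists q; last by rewrite -in_algE rmorphXn/= -dq /d; ring.
have : d != 0.
  by rewrite /d !mulf_neq0// subr_eq0// eq_sym.
by apply: contraNneq => q0; rewrite dq q0 scale0r.
Qed.

(* The discriminant -4 p^3 - 27 q^2 of the characteristic polynomial is a
   nonzero rational square, which forces p < 0. *)
Lemma qf_pos x : tr x = 0 -> x != 0 -> exists2 q : rat, 0 < q & qf x = q%:A.
Proof.
move=> t0 xN0; have [r rE] := sfix (s_qf t0).
exists r => //.
have sx : s x != x.
  apply: contraNneq xN0 => sx; move: t0; rewrite /conj_trace !sx => /eqP.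
  have -> : x + x + x = x * 3%:R by ring.
  by rewrite mulf_eq0 (negPf (alg_natrN0 _)) orbF.
have [q q0 qE] := disc_square sx; have [c cE] := sfix (s_nm x).
have eqK : 4%:R * (qf x) ^+ 3 = (q ^+ 2)%:A + 27%:R * (nm x) ^+ 2.
  by rewrite qE /conj_norm /conj_form tr0_ss//; ring.
have eqr : 4%:R * r ^+ 3 = q ^+ 2 + 27%:R * c ^+ 2.
  apply: (@in_alg_inj K); move: eqK; rewrite rE cE -!in_algE => eqK.
  transitivity (4%:R * in_alg K r ^+ 3); first by ring.
  by rewrite eqK; ring.
have q2 : 0 < q ^+ 2 by rewrite exprn_even_gt0.
have c2 := sqr_ge0 c.
rewrite ltNge; apply/negP => r0.
have : 0 <= (- r) ^+ 3 by rewrite exprn_ge0// oppr_ge0.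
by rewrite exprNn; nra.
Qed.
End CyclicCubic.

(** * The lattice of integers of trace zero *)

Section TraceZeroLattice.
Variables (K : fieldExtType rat) (s : {rmorphism K -> K}).
Hypothesis s3 : forall x, s (s (s x)) = x.
Hypothesis sfix : forall x, s x = x -> exists q : rat, x = q%:A.
Hypothesis sN1 : exists x, s x != x.
Implicit Types x y z m : K.
Local Notation O := (@ring_of_integers K).
Local Notation tr := (conj_trace s).
Local Notation qf := (conj_form s).
Local Notation nm := (conj_norm s).
Local Notation e2 := (conj_e2 s).

Definition trace0_integers : set K := [set x | O x /\ tr x = 0].
Local Notation M := trace0_integers.

Lemma s_in_alg (q : rat) : s (in_alg K q) = in_alg K q.
Proof.
rewrite -[q]divq_num_den fmorph_div fmorph_div/=.
by rewrite !in_alg_int !rmorph_int.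
Qed.

Lemma scale_in_alg (q : rat) x : q *: x = in_alg K q * x.
Proof. by rewrite mulr_algl. Qed.

(** On trace-zero elements [s] satisfies s^2 + s + 1 = 0 and acts as omega; a^2 - a b + b^2 is the
    norm of a + b omega. *)
Lemma qfZ x (a b : rat) : tr x = 0 ->
  qf (a *: x + b *: s x) = (eis_norm a b)%:A * qf x.
Proof.
move=> t0; rewrite /conj_form !scale_in_alg !(rmorphD s) !(rmorphM s) !s_in_alg tr0_ss// /eis_norm.
by ring.
Qed.

Lemma qfMz x (a b : int) : tr x = 0 ->
  qf (x *~ a + s x *~ b) = (eis_norm a b)%:~R * qf x.
Proof.
move=> t0; have := qfZ a%:~R b%:~R t0; rewrite !scaler_int => ->; congr (_ * _).
by rewrite -in_alg_int; congr (_%:A); rewrite /eis_norm; ring.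
Qed.

Lemma trace0_span m x : tr m = 0 -> m != 0 -> tr x = 0 ->
  exists a b : rat, x = a *: m + b *: s m.
Proof.
move=> tm mN0 tx; have [q q0 qE] := qf_pos s3 sfix tm mN0.
have qfN0 : qf m != 0 by rewrite qE -in_algE fmorph_eq0 gt_eqF.
(* Cramer's rule for x = a m + b s(m) and its conjugate s(x) = a s(m) + b s(s(m)); the determinant
   of this system is - qf m. *)
pose a := (x * (m + s m) + s x * s m) / qf m.
pose b := (s m * x - m * s x) / qf m.
have sa : s a = a.
  rewrite /a fmorph_div/= s_qf// !(rmorphD s, rmorphM s) !(tr0_ss tm) !(tr0_ss tx).
  by congr (_ / _); ring.
have sb : s b = b.
  rewrite /b fmorph_div/= s_qf// !(rmorphB s, rmorphM s) !(tr0_ss tm) !(tr0_ss tx).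
  by congr (_ / _); ring.
have [[u uE] [v vE]] := (sfix sa, sfix sb).
exists u, v; rewrite !scale_in_alg !in_algE -uE -vE /a /b; move: qfN0; rewrite /conj_form => qfN0.
by field.
Qed.

Lemma trace0_integers_neq0 : exists2 x, M x & x != 0.
Proof.
have [x0 sx0] := sN1; pose y := s x0 - x0.
have ty : tr y = 0 by rewrite /y trB tr_s// subrr.
have yN0 : y != 0 by rewrite subr_eq0.
have [[q qE] [r rE]] := (sfix (s_e2 s3 y), sfix (s_nm s3 y)).
(* Multiplying [y] by d multiplies [e2] by d^2 and the norm by d^3, which clears both denominators
   and makes the characteristic polynomial integral. *)
pose d := denq q * denq r.
have dN0 : d != 0 by rewrite mulf_neq0 ?denq_neq0.
exists (y *~ d); last first.
  by rewrite -mulrzr mulf_neq0// -(in_alg_int K d) -in_algE fmorph_eq0 intr_eq0.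
have dq : (numq q * denq r)%:~R = d%:~R * q :> rat.
  rewrite -[q in RHS]divq_num_den /d !intrM mulrAC; field.
  by rewrite intr_eq0 denq_neq0.
have dr : (numq r * denq q)%:~R = d%:~R * r :> rat.
  rewrite -[r in RHS]divq_num_den /d !intrM; field.
  by rewrite intr_eq0 denq_neq0.
split; last by rewrite trMz ty mul0rz.
apply: (@integral_charpoly K s _ 0 (d * (numq q * denq r)) (d ^+ 2 * (numq r * denq q))).
- by rewrite trMz ty mul0rz.
- transitivity (d%:~R * (d%:~R * e2 y)).
    by rewrite /conj_e2; ring.
  by rewrite qE -[RHS]in_alg_int intrM dq -in_algE -!(in_alg_int K d) -!in_algE; ring.
- transitivity (d%:~R ^+ 2 * (d%:~R * nm y)).
    by rewrite /conj_norm; ring.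
  by rewrite rE -[RHS]in_alg_int intrM dr -in_algE -!(in_alg_int K d) -!in_algE; ring.
Qed.

Lemma trace0_form_nat x : M x -> x != 0 -> exists2 n : nat, (0 < n)%N & qf x = n%:R.
Proof.
move=> [Ox tx] xN0; have [q q0 qE] := qf_pos s3 sfix tx xN0.
have : O (qf x) by rewrite /conj_form; apply: integersD; [apply: integersD|]; rewrite ?expr2; apply: integersM => //; apply: integers_conj.
rewrite qE => /integral_rat_int[[n|n] nE].
  exists n; first by move: q0; rewrite nE ltr0n.
  by rewrite nE -in_algE rmorph_nat.
by move: q0; rewrite nE NegzE mulrNz oppr_gt0 ltNge ler0n.
Qed.

Lemma trace0B x y : M x -> M y -> M (x - y).
Proof. by move=> [Ox tx] [Oy ty]; split; [apply: integersB|rewrite trB tx ty subr0]. Qed.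
Lemma trace0_conj x : M x -> M (s x).
Proof. by move=> [Ox tx]; split; [apply: integers_conj|rewrite tr_s]. Qed.
Lemma trace0_0 : M 0.
Proof. by split; [exact: integers0|rewrite /conj_trace !rmorph0 !addr0]. Qed.
Lemma trace0N x : M x -> M (- x).
Proof. by rewrite -(sub0r x); apply: trace0B; exact: trace0_0. Qed.
Lemma trace0D x y : M x -> M y -> M (x + y).
Proof. by move=> Mx My; rewrite -[y]opprK; apply: trace0B => //; apply: trace0N. Qed.
Lemma trace0Mz x (n : int) : M x -> M (x *~ n).
Proof. by move=> [Ox tx]; split; [exact: integersMz|rewrite trMz tx mul0rz]. Qed.

Lemma trace0_basis : exists m, [/\ M m, m != 0 &
  forall x, M x -> exists a b : int, x = m *~ a + s m *~ b].
Proof.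
(* The form takes values in [K], whereas the Euclidean argument compares rationals. [Q] reads off
   the rational value, with default 0 where there is none; on trace-zero elements there always is
   one. *)
pose Q x : rat := xget 0 [set q | qf x = q%:A].
have QE x : tr x = 0 -> qf x = (Q x)%:A.
  by move=> tx; have [q qE] := sfix (s_qf tx); apply: (@xgetPex _ 0 [set q | qf x = q%:A]); exists q.
have Q0 x : M x -> x != 0 -> Q x != 0.
  move=> [Ox tx] xN0; have [q q0] := qf_pos s3 sfix tx xN0.
  by rewrite QE// => /in_alg_inj ->; rewrite gt_eqF.
apply: (@eis_module_cyclic _ s M Q trace0B trace0_conj) => //.
- move=> m a b [_ tm]; apply: (@in_alg_inj K); rewrite -QE; last first.
    by rewrite /conj_trace !scale_in_alg !(rmorphD s) !(rmorphM s) !s_in_alg s3 (tr0_ss tm); ring.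
  by rewrite qfZ// QE// -!in_algE rmorphM.
- move=> x Mx; have [->|xN0] := eqVneq x 0.
    exists 0%N; apply: (@in_alg_inj K); rewrite -QE; last by case: trace0_0.
    by rewrite /conj_form rmorph0 scale0r; ring.
  have [n _ nE] := trace0_form_nat Mx xN0; exists n; apply: (@in_alg_inj K).
  by rewrite -QE ?nE; [rewrite -in_algE rmorph_nat|case: Mx].
- by move=> m x [_ tm] mN0 [_ tx]; exact: trace0_span.
- exact: trace0_integers_neq0.
Qed.

Lemma eis_norm_eq0 (a b : int) : eis_norm a b = 0 -> a = 0 /\ b = 0.
Proof. rewrite /eis_norm => h; nia. Qed.

(** The form at the difference of the two sides is an Eisenstein norm times the nonzero [qf m], and
    this norm is anisotropic. *)
Lemma trace0_coord_inj m (a b c d : int) : tr m = 0 -> m != 0 ->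
  m *~ a + s m *~ b = m *~ c + s m *~ d -> a = c /\ b = d.
Proof.
move=> tm mN0 E; have [q q0 qE] := qf_pos s3 sfix tm mN0.
have /eis_norm_eq0[] : eis_norm (a - c) (b - d) = 0.
  apply: (@intr_ext_inj K); apply: (@mulIf _ (qf m)).
    by rewrite qE -in_algE fmorph_eq0 gt_eqF.
  rewrite -qfMz// mul0r !mulrzBr addrACA -opprD E subrr.
  by rewrite /conj_form rmorph0; ring.
lia.
Qed.

Hypothesis tr1 : exists2 x, O x & tr x = 1.

Theorem trace1_basis : exists b m, [/\ O b, tr b = 1, M m, m != 0 & s b = b + m] /\
  forall x, M x -> exists a b : int, x = m *~ a + s m *~ b.
Proof.
have [m [Mm mN0 mB]] := trace0_basis; have [x Ox tx] := tr1.
have Md : M (s x - x) by split; [apply: integersB => //; exact: integers_conj|rewrite trB tr_s// subrr].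
have [a [b ab]] := mB _ Md.
have sx : s x = x + m *~ a + s m *~ b by rewrite -addrA -ab; ring.
have tm : tr m = 0 by case: Mm.
pose y c d := x + (m *~ c + s m *~ d).
have Oy c d : O (y c d).
  by apply: integersD => //; have [] : M (m *~ c + s m *~ d) by apply: trace0D; apply: trace0Mz => //; apply: trace0_conj.
have ty c d : tr (y c d) = 1.
  rewrite /y trD tx; have [_ ->] : M (m *~ c + s m *~ d); last by rewrite addr0.
  by apply: trace0D; apply: trace0Mz => //; apply: trace0_conj.
have sy c d : s (y c d) = y c d + (m *~ (a - c - d) + s m *~ (b + c - 2 * d)).
  rewrite /y !rmorphD !rmorphMz/= (tr0_ss tm) sx.
  by ring.
(* Once s(y) - y is m or -m, it generates the same module as m, so it can replace m. *)
have aux (e : int) c d : a - c - d = e -> b + c - 2 * d = 0 -> (e == 1) || (e == -1) ->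
  exists b m, [/\ O b, tr b = 1, M m, m != 0 & s b = b + m] /\
  forall x, M x -> exists a b : int, x = m *~ a + s m *~ b.
  move=> E1 E2 he; exists (y c d), (m *~ e); split.
    split=> //; first exact: trace0Mz.
      by case/orP: he => /eqP->; rewrite ?mulr1z// mulrN1z oppr_eq0.
    by rewrite sy E1 E2 mulr0z addr0.
  move=> z /mB[u [v ->]]; exists (e * u), (e * v).
  rewrite rmorphMz -!mulrzA; case/orP: he => /eqP->; congr (_ *~ _ + _ *~ _); lia.
have e3 : (exists d, a + b = 3 * d) \/ (exists d, a + b = 3 * d + 1)
    \/ (exists d, a + b = 3 * d - 1).
  have := divz_eq (a + b + 1) 3; set q := (_ %/ _)%Z; set r := (_ %% _)%Z => E.
  have r0 : 0 <= r by apply: modz_ge0.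
  have r3 : r < 3 by apply: ltz_pmod.
  have [r0E|[r1|r2]] : r = 0 \/ r = 1 \/ r = 2 by lia.
  - by right; right; exists q; lia.
  - by left; exists q; lia.
  - by right; left; exists q; lia.
case: e3 => [[d dE]|[[d dE]|[d dE]]].
(* In this class the shifted element is fixed by [s], hence an integer n, and its trace 3 n would
   have to be 1. *)
- have E1 : a - (a - d) - d = 0 by lia.
  have E2 : b + (a - d) - 2 * d = 0 by lia.
  have [//||n nE] := @fixed_int K s sfix (y (a - d) d).
    by rewrite sy E1 E2 !mulr0z !addr0.
  have := ty (a - d) d; rewrite nE /conj_trace !rmorph_int -!intrD => /(@intr_ext_inj K (n + n + n) 1).
  lia.
- by apply: (aux 1 (a - d - 1) d) => //; lia.
- by apply: (aux (-1) (a - d + 1) d) => //; lia.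
Qed.
End TraceZeroLattice.

(** * Tameness and the trace *)

Lemma dvdz3M (a b : int) : (3 %| a * b)%Z = (3 %| a)%Z || (3 %| b)%Z.
Proof. by rewrite !dvdzE abszM Euclid_dvdM. Qed.

Lemma dvdz3X (a : int) n : (3 %| a ^+ n.+1)%Z = (3 %| a)%Z.
Proof. by elim: n => [|n IHn]; rewrite ?expr1// exprS dvdz3M IHn orbb. Qed.

Lemma dvdz3_bezout (a : int) : ~~ (3 %| a)%Z -> exists u v : int, u * a + v * 3 = 1.
Proof.
move=> a3; have : coprimez a 3.
  by rewrite coprimezE coprime_sym prime_coprime// -dvdzE.
by move=> /coprimezP[[u v] /= uv]; exists u, v.
Qed.

Lemma dvdz3P (a : int) : reflect (exists k : int, a = 3 * k) (3 %| a)%Z.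
Proof.
apply: (iffP dvdzP) => [[k ->]|[k ->]]; exists k; ring.
Qed.

(** The determinant trick: a number that maps a finitely generated Z-module into itself is a root of
    the characteristic polynomial of an integer matrix. *)
Lemma integral_matrix_eigen (L : fieldExtType rat) n (C : 'M[int]_n) (v : 'rV[L]_n) (t : L) :
  v != 0 -> v *m map_mx intr C = t *: v -> ring_of_integers t.
Proof.
move=> vN0 vC; exists (char_poly C); first exact: char_poly_monic.
rewrite map_char_poly -eigenvalue_root_char; apply/eigenvalueP.
by exists v.
Qed.

Section IdealPowers.
Variable L : fieldExtType rat.
Implicit Types (P : set L) (x y : L).
Local Notation O := (@ring_of_integers L).

Lemma ideal_mul_mem P J x y : P x -> J y -> ideal_mul P J (x * y).
Proof.
move=> Px Jy; exists [:: (x, y)]; split; last by rewrite big_seq1.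
by move=> u; rewrite inE => /eqP->.
Qed.

Lemma ideal_mulD P J x y : ideal_mul P J x -> ideal_mul P J y -> ideal_mul P J (x + y).
Proof.
move=> [r [rP ->]] [t [tP ->]]; exists (r ++ t); split; last by rewrite big_cat.
by move=> u; rewrite mem_cat => /orP[/rP|/tP].
Qed.

Lemma ideal_mulZ P J a x : is_ideal P -> O a -> ideal_mul P J x -> ideal_mul P J (a * x).
Proof.
move=> [_ _ _ PM] Oa [r [rP ->]]; exists [seq (a * u.1, u.2) | u <- r]; split.
  by move=> _ /mapP[u /rP[Pu Ju] ->]; split => //; apply: PM.
by rewrite big_map mulr_sumr; apply: eq_bigr => u _; rewrite mulrA.
Qed.

Lemma ideal_expD P n x y : is_ideal P -> ideal_exp P n x -> ideal_exp P n y ->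
  ideal_exp P n (x + y).
Proof.
by move=> idP; case: n => [|n]; [exact: integersD|exact: ideal_mulD].
Qed.

Lemma ideal_expZ P n a x : is_ideal P -> O a -> ideal_exp P n x -> ideal_exp P n (a * x).
Proof.
by move=> idP; case: n => [|n] Oa; [exact: integersM|exact: ideal_mulZ].
Qed.

(** Elements of P^n are finite sums of products, to which norms do not apply directly. The single
    multiplier w^n turns membership into divisibility by p^n, of which a norm can be taken. *)
Lemma ideal_exp_div P n w p : (forall x, P x -> exists2 z, O z & w * x = p * z) ->
  forall x, ideal_exp P n x -> exists2 z, O z & w ^+ n * x = p ^+ n * z.
Proof.
move=> wP; elim: n => [|n IHn] x; first by exists x; rewrite ?expr0.
case=> r [rP ->] {x}; elim: r rP => [|u r IHr] rP.
  by exists 0; [exact: integers0|rewrite big_nil !mulr0].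
have [|z hz zE] := IHr; first by move=> v vr; apply: rP; rewrite inE vr orbT.
have [/wP[a Oa aE] /IHn[b Ob bE]] := rP u (mem_head _ _).
exists (a * b + z); first by apply: integersD => //; apply: integersM.
rewrite big_cons !mulrDr zE; congr (_ + _).
transitivity ((w * u.1) * (w ^+ n * u.2)); first by rewrite exprS; ring.
by rewrite aE bE exprS; ring.
Qed.
End IdealPowers.

Section TameTrace.
Variables (K : fieldExtType rat) (s : {rmorphism K -> K}).
Hypothesis s3 : forall x, s (s (s x)) = x.
Hypothesis sfix : forall x, s x = x -> exists q : rat, x = q%:A.
Hypothesis sN1 : exists x, s x != x.
Implicit Types x y z m : K.
Local Notation O := (@ring_of_integers K).
Local Notation tr := (conj_trace s).
Local Notation nm := (conj_norm s).
Local Notation e2 := (conj_e2 s).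
Local Notation M := (trace0_integers s).

(** The values of the trace on integers form an ideal of Z containing 3 = tr 1, so it is Z or 3
    Z. *)
Lemma trace1_or_div : (exists2 x, O x & tr x = 1) \/
  (forall x, O x -> exists t : int, tr x = (3 * t)%:~R).
Proof.
have [?|no] := pselect (exists2 x, O x & tr x = 1); [by left|right].
move=> x Ox; have [n nE] := tr_int s3 sfix Ox.
have [/dvdz3P[k kE]|/dvdz3_bezout[u [v uv]]] := boolP (3 %| n)%Z.
  by exists k; rewrite nE kE.
exfalso; apply: no; exists (x *~ u + v%:~R).
  by apply: integersD; [exact: integersMz|exact: integers_int].
rewrite trD trMz nE /conj_trace !rmorph_int -mulrzr -intrM -!intrD.
by rewrite -[1]/(1%:~R); congr (_%:~R); lia.
Qed.

Hypothesis trdiv : forall x, O x -> exists t : int, tr x = (3 * t)%:~R.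

(** Newton's identity tr(x^2) + 2 e2(x) = tr(x)^2, with 2 invertible modulo 3. *)
Lemma wild_e2 x : O x -> exists t : int, e2 x = (3 * t)%:~R.
Proof.
move=> Ox; have [t tE] := trdiv Ox; have [u uE] := trdiv (integersM Ox Ox).
have [v vE] := e2_int s3 sfix Ox.
have : tr (x * x) + 2%:R * e2 x = tr x ^+ 2 by rewrite /conj_trace /conj_e2; ring.
rewrite tE uE vE => E.
have {}E : 3 * u + 2 * v = (3 * t) ^+ 2.
  apply: (@intr_ext_inj K); transitivity ((3 * u)%:~R + 2%:R * v%:~R : K).
    by ring.
  by rewrite E; ring.
have -> : v = 3 * (v - (3 * t ^+ 2 - u)).
  apply/eqP; rewrite -subr_eq0; apply/eqP; transitivity ((3 * t) ^+ 2 - (3 * u + 2 * v)).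
    by ring.
  by rewrite E subrr.
by eexists; reflexivity.
Qed.

Definition div3 x := exists2 y, O y & x = 3%:R * y.

Lemma div3D x y : div3 x -> div3 y -> div3 (x + y).
Proof. by move=> [a Oa ->] [b Ob ->]; exists (a + b); [exact: integersD|ring]. Qed.
Lemma div3B x y : div3 x -> div3 y -> div3 (x - y).
Proof. by move=> [a Oa ->] [b Ob ->]; exists (a - b); [exact: integersB|ring]. Qed.
Lemma div3M x y : O x -> div3 y -> div3 (x * y).
Proof. by move=> Ox [b Ob ->]; exists (x * b); [exact: integersM|ring]. Qed.
Lemma div3_mul3 x : O x -> div3 (3%:R * x). Proof. by exists x. Qed.

Lemma div3_int (n : int) : div3 n%:~R -> (3 %| n)%Z.
Proof.
move=> [y Oy /(congr1 nm)]; rewrite nm_int nmM -[3%:R]/(3%:~R) nm_int.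
have [k ->] := nm_O_int s3 sfix Oy; rewrite -intrM => /intr_ext_inj E.
rewrite -(@dvdz3X _ 2) E; apply/dvdz3P; exists (9 * k); ring.
Qed.

Lemma cube_nm x : O x -> div3 (x ^+ 3 - nm x).
Proof.
move=> Ox; have [t tE] := trdiv Ox; have [u uE] := wild_e2 Ox.
exists (t%:~R * x ^+ 2 - u%:~R * x).
  by apply: integersB; apply: integersM => //; [exact: integers_int|exact: integersX|exact: integers_int].
by apply/eqP; rewrite -subr_eq0 -[X in _ == X](charpolyE s x) tE uE; apply/eqP; ring.
Qed.

Definition wildP : set K := [set x | O x /\ exists k : int, nm x = (3 * k)%:~R].
Local Notation P := wildP.

(** The two descriptions of [P] complement each other: the norm is multiplicative and shows
    primality, while cubing is additive modulo 3 and shows closure under sums. *)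
Lemma wildP_cube x : O x -> P x <-> div3 (x ^+ 3).
Proof.
move=> Ox; split=> [[_ [k kE]]|h].
  rewrite -[x ^+ 3](subrK (nm x)); apply: div3D; first exact: cube_nm.
  by rewrite kE intrM; apply: div3_mul3; apply: integers_int.
split=> //; have [n nE] := nm_O_int s3 sfix Ox.
have : div3 (n%:~R : K).
  by rewrite -nE -[nm x](subKr (x ^+ 3)); apply: div3B => //; apply: cube_nm.
by move/div3_int/dvdz3P => [k kE]; exists k; rewrite nE kE.
Qed.

Lemma wildP_ideal : is_ideal P.
Proof.
split=> [x []//|| x y Px Py| a x Oa Px].
- by split; [exact: integers0|exists 0; rewrite /conj_norm mul0r mul0r].
- have [[Ox _] [Oy _]] := (Px, Py).
  apply/wildP_cube; first exact: integersD.
  have -> : (x + y) ^+ 3 = x ^+ 3 + y ^+ 3 + 3%:R * (x * y * (x + y)) by ring.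
  apply: div3D; first by apply: div3D; apply/wildP_cube.
  by apply: div3_mul3; apply: integersM; [exact: integersM|exact: integersD].
- have [Ox _] := Px; apply/wildP_cube; first exact: integersM.
  by rewrite exprMn; apply: div3M; [exact: integersX|apply/wildP_cube].
Qed.

Lemma wildP_int (n : int) : P n%:~R <-> (3 %| n)%Z.
Proof.
split=> [[_ [k]]|/dvdz3P[k ->]].
  rewrite nm_int => /intr_ext_inj E; rewrite -(@dvdz3X _ 2) E.
  by apply/dvdz3P; exists k.
split; first exact: integers_int.
by exists (9 * k ^+ 3); rewrite nm_int; congr (_%:~R); ring.
Qed.

Lemma wildP_prime : is_prime_ideal P.
Proof.
split; first exact: wildP_ideal.
  by move=> /(wildP_int 1).
move=> x y Ox Oy [_ [k]]; rewrite nmM.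
have [[a aE] [b bE]] := (nm_O_int s3 sfix Ox, nm_O_int s3 sfix Oy).
rewrite aE bE -intrM => /intr_ext_inj E.
have : (3 %| a * b)%Z by apply/dvdz3P; exists k.
rewrite dvdz3M => /orP[]/dvdz3P[t tE]; [left|right]; split=> //; exists t; congruence.
Qed.

(** The residue field of [P] is F_3, and n = [nm x] represents [x]: modulo 3 the cube of x - n is
    x^3 - n^3, congruent to n - n^3, which 3 divides. *)
Lemma wildP_residue x : O x -> exists c : int, P (x - c%:~R).
Proof.
move=> Ox; have [n nE] := nm_O_int s3 sfix Ox; exists n.
apply/wildP_cube; first by apply: integersB => //; exact: integers_int.
have -> : (x - n%:~R) ^+ 3 = (x ^+ 3 - n%:~R) - 3%:R * (x * n%:~R * (x - n%:~R))
   - (n ^+ 3 - n)%:~R by ring.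
apply: div3B; first apply: div3B.
- by rewrite -nE; apply: cube_nm.
- by apply: div3_mul3; do !apply: integersM => //; rewrite ?integers_int//; [exact: integers_int|apply: integersB => //; exact: integers_int].
- have [k ->] : exists k, n ^+ 3 - n = 3 * k.
    have := divz_eq n 3; set q := (_ %/ _)%Z; set r := (_ %% _)%Z => E.
    have r0 : 0 <= r by apply: modz_ge0.
    have r3 : r < 3 by apply: ltz_pmod.
    have [->|[->|->]] : n = 3 * q \/ n = 3 * q + 1 \/ n = 3 * q + 2 by lia.
    + by exists (9 * q ^+ 3 - q); ring.
    + by exists (9 * q ^+ 3 + 9 * q ^+ 2 + 2 * q); ring.
    + by exists (9 * q ^+ 3 + 18 * q ^+ 2 + 11 * q + 2); ring.
  by rewrite intrM; apply: div3_mul3; apply: integers_int.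
Qed.
End TameTrace.

(** * Ramification index 3 above the prime 3 when every trace is divisible by 3 *)

Section WildRamification.
Variables (K : fieldExtType rat) (s : {rmorphism K -> K}).
Hypothesis s3 : forall x, s (s (s x)) = x.
Hypothesis sfix : forall x, s x = x -> exists q : rat, x = q%:A.
Hypothesis sN1 : exists x, s x != x.
Implicit Types x y z m : K.
Local Notation O := (@ring_of_integers K).
Local Notation tr := (conj_trace s).
Local Notation nm := (conj_norm s).
Local Notation M := (trace0_integers s).
Hypothesis trdiv : forall x, O x -> exists t : int, tr x = (3 * t)%:~R.
Local Notation P := (wildP s).
Local Notation div3 := (@div3 K).

Let idP : is_ideal P := wildP_ideal s3 sfix trdiv.
Let PD x y : P x -> P y -> P (x + y). Proof. by case: idP => _ _ h _; apply: h. Qed.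
Let PM a x : O a -> P x -> P (a * x). Proof. by case: idP => _ _ _ h; apply: h. Qed.

Lemma div3_bezout (a : int) x : ~~ (3 %| a)%Z -> O x -> div3 (a%:~R * x) -> div3 x.
Proof.
move=> /dvdz3_bezout[u [v uv]] Ox ax.
have -> : x = u%:~R * (a%:~R * x) + 3%:R * (v%:~R * x).
  transitivity ((u * a + v * 3)%:~R * x); first by rewrite uv mul1r.
  by ring.
by apply: div3D; [apply: div3M => //; exact: integers_int|apply: div3_mul3; apply: integersM => //; exact: integers_int].
Qed.

(** Since x^3 lies in 3 O_K, at most three multiplications by [x] bring [y] into 3 O_K; [k] counts
    those made before the one that succeeds. *)
Lemma div3_cancel_power x y : O y -> P x -> ~ div3 y ->
  exists k, ~ div3 (x ^+ k * y) /\ div3 (x ^+ k.+1 * y).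
Proof.
move=> Oy Px yN; have [Ox _] := Px.
have h3 : div3 (x ^+ 3 * y).
  by rewrite mulrC; apply: div3M => //; apply/(wildP_cube s3 sfix trdiv).
have [h1|h1] := pselect (div3 (x ^+ 1 * y)); first by exists 0%N; rewrite expr0 mul1r.
have [h2|h2] := pselect (div3 (x ^+ 2 * y)); first by exists 1%N.
by exists 2%N.
Qed.

(* Let y = A^k B^l be outside 3 O_K with y A and y B inside, where P = (3, A, B).
   Then y / 3 maps P into O_K, but not into P since y / 3 is not integral. *)
Lemma wild_local_generator m c d :
    (forall x, O x -> exists t i j : int, x = t%:~R + m *~ i + s m *~ j) ->
    P (m - c%:~R) -> P (s m - d%:~R) ->
  exists w p, [/\ O w, ~ P w, P p & forall x, P x -> exists2 z, O z & w * x = p * z].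
Proof.
move=> span; set A := m - _; set B := s m - _ => PA PB.
have [[OA _] [OB' _]] := (PA, PB).
have PE x : P x -> exists k i j : int, x = 3%:R * k%:~R + i%:~R * A + j%:~R * B.
  move=> Px; have [Ox _] := Px; have [t [i [j xE]]] := span x Ox.
  have tE : (t + c * i + d * j)%:~R = x + - i%:~R * A + - j%:~R * B.
    by rewrite xE /A /B; ring.
  have : P (t + c * i + d * j)%:~R.
    rewrite tE; apply: PD; first apply: PD => //.
      by apply: PM => //; rewrite -intrN; exact: integers_int.
    by apply: PM => //; rewrite -intrN; exact: integers_int.
  move=> /(wildP_int s)/dvdz3P[k kE]; exists k, i, j.
  transitivity ((3 * k)%:~R + i%:~R * A + j%:~R * B); last by rewrite intrM.
  by rewrite -kE tE; ring.
have N1 : ~ div3 1 by move=> /(div3_int s3 sfix (n := 1)).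
have [k [k1 k2]] := div3_cancel_power (integers1 K) PA N1.
have Oy1 : O (A ^+ k * 1) by apply: integersM; [exact: integersX|exact: integers1].
have [l [l1 l2]] := div3_cancel_power Oy1 PB k1.
set y := B ^+ l * (A ^+ k * 1) in l1.
have Oy : O y by apply: integersM => //; apply: integersX.
have yA : div3 (y * A).
  have -> : y * A = B ^+ l * (A ^+ k.+1 * 1) by rewrite exprS /y; ring.
  by apply: div3M => //; apply: integersX.
have yB : div3 (y * B).
  by have -> : y * B = B ^+ l.+1 * (A ^+ k * 1) by rewrite exprS /y; ring.
have n3 : (3%:R : K) != 0 by exact: alg_natrN0.
pose t := y / 3%:R.
have y3 : div3 (y * 3%:R) by rewrite mulrC; apply: div3_mul3.
have tO x : div3 (y * x) -> O (t * x).
  by case=> z hz zE; rewrite /t mulrAC zE mulrAC divff// mul1r.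
have P3 : P 3%:R by apply/(wildP_int s 3).
have [p [Pp yp tp]] : exists p, [/\ P p, div3 (y * p) & ~ P (t * p)].
  apply: contrapT => no.
  have inP x : P x -> div3 (y * x) -> P (t * x).
    by move=> Px yx; apply: contrapT => h; apply: no; exists x.
  have [a11 [a12 [a13 E1]]] := PE _ (inP _ P3 y3).
  have [a21 [a22 [a23 E2]]] := PE _ (inP _ PA yA).
  have [a31 [a32 [a33 E3]]] := PE _ (inP _ PB yB).
  pose v : 'rV[K]_3 := \row_j [:: 3%:R; A; B]`_j.
  (* Column j holds the coordinates of t times the j-th of the generators 3, A, B of P. If t mapped
     P into itself, it would be an eigenvalue of this integer matrix, hence integral, and y = 3 t
     would lie in 3 O_K. *)
  pose C : 'M[int]_3 :=
    \matrix_(i, j) (nth [::] [:: [:: a11; a21; a31]; [:: a12; a22; a32]; [:: a13; a23; a33]] i)`_j.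
  have : O t.
    apply: (@integral_matrix_eigen _ _ C v).
      by apply/eqP => /rowP/(_ ord0); rewrite !mxE/= => /eqP; rewrite (negPf n3).
    apply/rowP => j; rewrite !mxE !big_ord_recl big_ord0 !mxE/=.
    case: j => [[|[|[|//]]] ?]; rewrite /= ?E1 ?E2 ?E3; ring.
  move=> Ot; apply: l1; exists t => //.
  by rewrite /t mulrC mulfVK.
exists (t * p), p; split=> // [|x Px]; first exact: tO.
have [k' [i [j xE]]] := PE _ Px.
exists (t * x); last by ring.
apply: tO; rewrite xE.
have -> : y * (3%:R * k'%:~R + i%:~R * A + j%:~R * B) =
  k'%:~R * (y * 3%:R) + i%:~R * (y * A) + j%:~R * (y * B) by ring.
by apply: div3D; first apply: div3D; apply: div3M => //; exact: integers_int.
Qed.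

Lemma notP_residue x : O x -> ~ P x ->
  exists c : int, ~~ (3 %| c)%Z /\ P (x - c%:~R).
Proof.
move=> Ox xN; have [c Pc] := wildP_residue s3 sfix trdiv Ox; exists c; split=> //.
apply/negP => /(wildP_int s) h; apply: xN.
by rewrite -[x](subrK c%:~R); apply: PD.
Qed.

Lemma notP_nm x : O x -> ~ P x -> exists2 n : int, nm x = n%:~R & ~~ (3 %| n)%Z.
Proof.
move=> Ox xN; have [n nE] := nm_O_int s3 sfix Ox; exists n => //.
by apply/negP => /dvdz3P[k kE]; apply: xN; split=> //; exists k; rewrite nE kE.
Qed.

Lemma notPM x y : O x -> O y -> ~ P x -> ~ P y -> ~ P (x * y).
Proof.
by move=> Ox Oy xN yN; have [_ _ h] := wildP_prime s3 sfix trdiv => /(h _ _ Ox Oy)[].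
Qed.

Lemma notPX x n : O x -> ~ P x -> ~ P (x ^+ n).
Proof.
move=> Ox xN; elim: n => [|n IHn]; first by case: (wildP_prime s3 sfix trdiv).
by rewrite exprS; apply: notPM => //; apply: integersX.
Qed.

(* w is a unit and p a generator of P locally at P. *)
Lemma maximal_exponent_cofactor w p r e : O w -> ~ P w -> P p -> O r ->
  w ^+ e * 3%:R = p ^+ e * r -> ideal_exp P e 3%:R -> ~ ideal_exp P e.+1 3%:R -> ~ P r.
Proof.
move=> Ow wN Pp Or E Pe PeN Pr; apply: PeN.
have h : ideal_exp P e.+1 (w ^+ e * 3%:R).
  rewrite E; have {E Pe} : P r by [].
  clear -idP Pp Or; elim: e => [|e IHe] Pr.
    by rewrite expr0 mul1r -[r]mulr1; apply: ideal_mul_mem => //; exact: integers1.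
  by rewrite exprS -mulrA; apply: ideal_mul_mem => //; apply: IHe.
(* Modulo P, w^e is an integer c prime to 3. Hence 3 is an integral combination of w^e 3, (w^e - c)
   3 and 9, all of which lie in P^(e+1). *)
have [c [c3 Pc]] := notP_residue (integersX e Ow) (notPX (n := e) Ow wN).
have h2 : ideal_exp P e.+1 ((w ^+ e - c%:~R) * 3%:R) by exact: ideal_mul_mem.
have h3 : ideal_exp P e.+1 (3%:R * 3%:R).
  by apply: ideal_mul_mem => //; apply/(wildP_int s 3).
have [u [v uv]] := dvdz3_bezout c3.
have -> : (3%:R : K) = u%:~R * (w ^+ e * 3%:R) + (- u%:~R * ((w ^+ e - c%:~R) * 3%:R)
    + v%:~R * (3%:R * 3%:R)).
  transitivity ((u * c + v * 3)%:~R * 3%:R : K); first by rewrite uv mul1r.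
  by ring.
apply: ideal_expD => //; first by apply: ideal_expZ => //; exact: integers_int.
apply: ideal_expD => //; apply: ideal_expZ => //; last exact: integers_int.
by rewrite -intrN; exact: integers_int.
Qed.

Theorem wild_not_tame : ~ tamely_ramified K.
Proof.
move=> tame; have [m [Mm mN0 mB]] := trace0_basis s3 sfix sN1.
have [Om tm] := Mm.
have span x : O x -> exists t i j : int, x = t%:~R + m *~ i + s m *~ j.
  move=> Ox; have [t tE] := trdiv Ox.
  have [i [j ij]] : exists i j : int, x - t%:~R = m *~ i + s m *~ j.
    apply: mB; split; first by apply: integersB => //; exact: integers_int.
    by rewrite trB tE /conj_trace !rmorph_int; ring.
  by exists t, i, j; rewrite -addrA -ij; ring.
have [c Pc] := wildP_residue s3 sfix trdiv Om.
have [d Pd] := wildP_residue s3 sfix trdiv (integers_conj s Om).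
have [w [p [Ow wN Pp wp]]] := wild_local_generator span Pc Pd.
have [a aE a3] := notP_nm Ow wN.
have [Op [b bE]] := Pp.
have div e : ideal_exp P e 3%:R -> exists r, [/\ O r, w ^+ e * 3%:R = p ^+ e * r
    & exists2 n : int, nm r = n%:~R & a ^+ e * 27 = (3 * b) ^+ e * n].
  move=> /(ideal_exp_div wp)[r Or rE]; exists r; split=> //.
  have [n nE] := nm_O_int s3 sfix Or; exists n => //.
  have nmX x k : nm (x ^+ k) = nm x ^+ k.
    elim: k => [|k IHk]; last by rewrite !exprS nmM IHk.
    by rewrite !expr0 /conj_norm !rmorph1 !mulr1.
  apply: (@intr_ext_inj K).
  have := congr1 nm rE; rewrite !nmM !nmX aE bE nE -[3%:R]/(3%:~R) nm_int => E.
  rewrite intrM (rmorphXn intr) [RHS]intrM [X in _ = X * _](rmorphXn intr) /= -E.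
  by congr (_ * _).
have max e : ideal_exp P e 3%:R -> ~ ideal_exp P e.+1 3%:R ->
  exists r, [/\ O r, ~ P r, w ^+ e * 3%:R = p ^+ e * r
    & exists2 n : int, ~~ (3 %| n)%Z & a ^+ e * 27 = (3 * b) ^+ e * n].
  move=> Pe PeN; have [r [Or rE [n nE E]]] := div e Pe.
  have rN := maximal_exponent_cofactor Ow wN Pp Or rE Pe PeN.
  exists r; split=> //; exists n => //.
  by have [n' n'E] := notP_nm Or rN; move: nE; rewrite n'E => /intr_ext_inj ->.
have P3 : P 3%:R by apply/(wildP_int s 3).
have P1 : ideal_exp P 1 3%:R.
  by rewrite -[3%:R]mulr1; apply: ideal_mul_mem => //; exact: integers1.
(* For maximal exponent 1 the norm equation 9 a = b n is no contradiction. Instead r (m - c) lies in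
   3 O_K with r outside P, so m - c lies in 3 O_K; its trace shows that 3 divides c, and then m / 3
   is a trace-zero integer that is not in the span of m and s(m). *)
have P2 : ideal_exp P 2 3%:R.
  apply: contrapT => /(max 1%N P1)[r [Or rN rE _]].
  have [z hz zE] := wp _ Pc.
  have wN0 : w != 0 by apply/eqP => w0; apply: wN; rewrite w0; case: idP.
  have rA : div3 (r * (m - c%:~R)).
    exists z => //; apply: (mulfI wN0).
    by rewrite mulrCA zE; move: rE; rewrite !expr1 => rE; rewrite [RHS]mulrA rE; ring.
  have OA : O (m - c%:~R) by case: Pc.
  have [n nE n3] := notP_nm Or rN.
  have [z2 Oz2 z2E] : div3 (m - c%:~R).
    apply: (div3_bezout n3 OA); rewrite -nE.
    have -> : nm r * (m - c%:~R) = r ^+ 2 * (r * (m - c%:~R)) -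
      (m - c%:~R) * (r ^+ 3 - nm r) by ring.
    apply: div3B; first by apply: div3M => //; exact: integersX.
    by apply: div3M => //; exact: cube_nm s3 sfix trdiv _ Or.
  have [t tE] := trdiv Oz2.
  have cE : c = - 3 * t.
    apply: (@intr_ext_inj K); apply: (mulfI (alg_natrN0 K 2)).
    have := congr1 tr z2E.
    have -> : tr (m - c%:~R) = - (3%:R * c%:~R) by rewrite trB tm /conj_trace !rmorph_int; ring.
    have -> : tr (3%:R * z2) = 3%:R * tr z2 by rewrite /conj_trace; ring.
    by rewrite tE => /(congr1 -%R); rewrite opprK => ->; ring.
  have [i [j ij]] : exists i j : int, z2 - t%:~R = m *~ i + s m *~ j.
    apply: mB; split; first by apply: integersB => //; exact: integers_int.
    by rewrite trB tE /conj_trace !rmorph_int; ring.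
  have : m *~ 1 + s m *~ 0 = m *~ (3 * i) + s m *~ (3 * j).
    transitivity (3%:R * (z2 - t%:~R)); last by rewrite ij; ring.
    by rewrite mulrBr -z2E cE; ring.
  by case/(trace0_coord_inj s3 sfix tm mN0) => ? _; lia.
(* Maximal exponent 2 gives 3 a^2 = b^2 n with a and n prime to 3, where 3 occurs to an odd power on
   the left and to an even power on the right. *)
have P3' : ideal_exp P 3 3%:R.
  apply: contrapT => /(max 2%N P2)[r [Or rN rE [n n3 E]]].
  have {}E : 3 * a ^+ 2 = b ^+ 2 * n.
    have : 9 * (3 * a ^+ 2) = 9 * (b ^+ 2 * n).
      by transitivity (a ^+ 2 * 27); [ring|rewrite E; ring].
    by move=> /mulfI; apply.
  have : (3 %| b ^+ 2 * n)%Z by apply/dvdz3P; exists (a ^+ 2).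
  rewrite dvdz3M (negPf n3) orbF dvdz3X => /dvdz3P[k kE].
  move/negP: a3; apply; rewrite -(@dvdz3X _ 1); apply/dvdz3P; exists (k ^+ 2 * n).
  by apply: (@mulfI _ 3) => //; rewrite E kE; ring.
(* Membership in P^4 would make 81 divide 27 a^4, although a is prime to 3. *)
have P4 : ~ ideal_exp P 4 3%:R.
  move=> /div[r [_ _ [n _ E]]].
  move/negP: a3; apply; rewrite -(@dvdz3X _ 3); apply/dvdz3P; exists (b ^+ 4 * n).
  have : 27 * a ^+ 4 = 27 * (3 * (b ^+ 4 * n)).
    by transitivity (a ^+ 4 * 27); [ring|rewrite E; ring].
  by move=> /mulfI; apply.
have ram : is_ramification_index 3 P 3.
  split; first by move=> _ [x Ox <-]; rewrite mulrC; apply: ideal_expZ.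
  by move=> h; apply: P4; apply: h; exists 1; [exact: integers1|rewrite mulr1].
by have := tame 3%N P 3%N isT (wildP_prime s3 sfix trdiv) P3 ram.
Qed.
End WildRamification.

Lemma tame_trace1 (K : fieldExtType rat) (s : {rmorphism K -> K}) :
    (forall x, s (s (s x)) = x) -> (forall x, s x = x -> exists q : rat, x = q%:A) ->
    (exists x, s x != x) -> tamely_ramified K ->
  exists2 x, ring_of_integers x & conj_trace s x = 1.
Proof.
move=> s3 sfix sN1 tame.
by have [//|h] := trace1_or_div s3 sfix; case: (wild_not_tame s3 sfix sN1 h).
Qed.

(** * The discriminant *)

(** A group of order 3 is cyclic. The later arguments see the Galois group only through these
    properties of a generator. *)
Lemma abelian_cubic_generator (K : splittingFieldType rat) : abelian_cubic K ->
  exists s : {rmorphism K -> K}, [/\ (forall x, s (s (s x)) = x),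
    (forall x, s x = x -> exists q : rat, x = q%:A), (exists x, s x != x)
    & forall x, galTrace 1 {:K} x = conj_trace s x].
Proof.
case=> dim3 galK.
have cardG : #|('Gal({:K} / 1))%g| = 3%N by rewrite -galois_dim// dim3 dimv1 divn1.
have /cyclicP[g Gg] : cyclic ('Gal({:K} / 1))%g by apply: prime_cyclic; rewrite cardG.
have og : #[g]%g = 3%N by rewrite /order -Gg.
have fixg x : g x = x -> exists q : rat, x = q%:A.
  move=> gx; apply/vlineP; rewrite -(galois_fixedField galK).
  apply/fixedFieldP; first exact: memvf.
  move=> h; rewrite Gg => /cycleP[i ->]; elim: i => [|i IHi].
    by rewrite expg0 gal_id.
  by rewrite expgSr galM ?memvf// IHi.
exists (g : K -> K); split=> //.
- move=> x /=; have := expg_order g; rewrite og !expgS expg0 mulg1 => g3.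
  by rewrite -[RHS](@gal_id _ _ {:K}) -g3 !galM ?memvf.
- apply: contrapT => no.
  have all1 x : g x = x by apply: contrapT => gx; apply: no; exists x; apply/eqP.
  have : g = 1%g by apply/eqP/gal_eqP => x _; rewrite gal_id all1.
  by move=> g1; move: og; rewrite g1 order1.
- move=> x; rewrite /galTrace Gg.
  have gN1 : (1 == g)%g = false by rewrite eq_sym -order_eq1 og.
  have g2N1 : (1 == g ^+ 2)%g = false by rewrite eq_sym -order_dvdn og.
  have g2Ng : (g == g ^+ 2)%g = false.
    by rewrite expgS expg1 eq_mulVg1 mulgA mulVg mul1g eq_sym.
  have -> : <[g]>%g = (1%g |: (g |: [set (g ^+ 2)%g]))%SET.
    apply/eqP; rewrite eq_sym eqEcard; apply/andP; split.
      apply/fintype.subsetP => h; rewrite !inE.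
      by move=> /orP[|/orP[]] /eqP->; rewrite ?group1 ?cycle_id ?mem_cycle.
    by rewrite -/(order g) og !cardsU1 cards1 !inE gN1 g2N1 g2Ng.
  rewrite !big_setU1 ?inE ?gN1 ?g2N1 ?g2Ng//= big_set1 gal_id expgS expg1 galM ?memvf//.
  by rewrite /conj_trace addrA.
Qed.

Lemma det_mx33 (R : comPzRingType) (F : nat -> nat -> R) :
  \det (\matrix_(i < 3, j < 3) F i j) =
    F 0%N 0%N * (F 1%N 1%N * F 2%N 2%N - F 1%N 2%N * F 2%N 1%N) - F 0%N 1%N * (F 1%N 0%N * F 2%N 2%N - F 1%N 2%N * F 2%N 0%N)
    + F 0%N 2%N * (F 1%N 0%N * F 2%N 1%N - F 1%N 1%N * F 2%N 0%N) :> R.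
Proof.
rewrite (expand_det_row _ ord0) !big_ord_recl big_ord0 /cofactor.
rewrite !(expand_det_row _ ord0) !big_ord_recl !big_ord0 /cofactor.
by rewrite !det_mx11 !mxE /= /bump /=; ring.
Qed.

Section Discriminant.
Variables (K : splittingFieldType rat) (s : {rmorphism K -> K}).
Hypothesis s3 : forall x, s (s (s x)) = x.
Hypothesis sfix : forall x, s x = x -> exists q : rat, x = q%:A.
Hypothesis strace : forall x, galTrace 1 {:K} x = conj_trace s x.
Local Notation O := (@ring_of_integers K).
Local Notation tr := (conj_trace s).
Local Notation M := (trace0_integers s).
Variables (b m : K) (N : nat).
Hypotheses (Ob : O b) (trb : tr b = 1) (Mm : M m) (mN0 : m != 0) (sb : s b = b + m).
Hypothesis mB : forall x, M x -> exists a c : int, x = m *~ a + s m *~ c.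
Hypothesis qfm : conj_form s m = N%:R.

Let v : 'I_3 -> K := fun i => [:: b; m; s m]`_i.

Lemma integers_coord x : O x -> exists t i j : int, x = b *~ t + m *~ i + s m *~ j.
Proof.
move=> Ox; have [t tE] := tr_int s3 sfix Ox.
have [i [j ij]] : exists i j : int, x - b *~ t = m *~ i + s m *~ j.
  apply: mB; split; first by apply: integersB => //; apply: integersMz.
  by rewrite trB trMz trb tE subrr.
by exists t, i, j; rewrite -addrA -ij; ring.
Qed.

(** The Gram determinant is the square of the determinant of the conjugates of b, m, s(m), which is
    tr(b) times the form at m up to sign. With m = s(b) - b this becomes a polynomial identity in
    the conjugates of b. *)
Lemma det_trace_basis : \det (\matrix_(i, j) tr (v i * v j)) = (N ^ 2)%:R.
Proof.
rewrite (det_mx33 (fun i j => tr ([:: b; m; s m]`_i * [:: b; m; s m]`_j))) /=.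
have -> : (N ^ 2)%:R = tr b ^+ 2 * conj_form s m ^+ 2 by rewrite trb qfm natrX; ring.
have -> : m = s b - b by rewrite sb; ring.
by rewrite /conj_trace /conj_form !(rmorphB s, rmorphM s) !s3; ring.
Qed.

(** Both transition matrices are integral, and cancelling N^2 shows that their squared determinants
    have product 1. The size is a variable [n] because the dimension of [K] occurs in the index type
    of a basis, and only a variable can be replaced by 3. *)
Lemma change_of_basis_det n (e : 'I_n -> K) (C : 'I_n -> 'I_3 -> int) :
  n = 3%N -> (forall i, e i = \sum_j v j *~ C i j) ->
  (forall j, exists c : 'I_n -> int, v j = \sum_i e i *~ c i) ->
  \det (\matrix_(i, j) tr (e i * e j)) = (N ^ 2)%:R.
Proof.
move=> n3; subst n => eE /choice[D vE].
have gram (f g : 'I_3 -> K) (A : 'I_3 -> 'I_3 -> int) :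
    (forall i, f i = \sum_j g j *~ A i j) ->
  \det (\matrix_(i, j) tr (f i * f j)) =
  (\det (\matrix_(i, j) A i j) ^+ 2)%:~R * \det (\matrix_(i, j) tr (g i * g j)).
  move=> fE; pose B := map_mx (intr : int -> K) (\matrix_(i, j) A i j).
  have -> : \matrix_(i, j) tr (f i * f j) = B *m (\matrix_(i, j) tr (g i * g j)) *m B^T.
    apply/matrixP => i j; rewrite !mxE fE (fE j).
    have trsum (F : 'I_3 -> K) : tr (\sum_k F k) = \sum_k tr (F k).
      by rewrite /conj_trace !rmorph_sum -!big_split.
    rewrite big_distrlr trsum /=; under eq_bigr do rewrite trsum.
    rewrite exchange_big /=; apply: eq_bigr => k _.
    rewrite !mxE mulr_suml; apply: eq_bigr => l _.
    by rewrite !mxE /conj_trace; ring.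
  by rewrite !det_mulmx det_tr /B det_map_mx rmorphXn/=; ring.
set G := \det _ in gram *; have := gram _ _ _ vE; rewrite det_trace_basis.
rewrite /G (gram _ _ _ eE) det_trace_basis.
set p := \det _; set q := \det _ => E.
have NN0 : (N ^ 2)%:R != 0 :> K.
  have : (N ^ 2)%:R = conj_form s m ^+ 2 by rewrite qfm natrX.
  move=> ->; rewrite expf_neq0//; have [_ tm] := Mm.
  by have [r r0 ->] := qf_pos s3 sfix tm mN0; rewrite -in_algE fmorph_eq0 gt_eqF.
have {}E : p ^+ 2 * q ^+ 2 = 1.
  by apply: (@intr_ext_inj K); apply: (mulIf NN0); rewrite mul1r intrM -mulrA -E.
have -> : q ^+ 2 = 1.
  move: (sqr_ge0 p) (sqr_ge0 q) E; move: (p ^+ 2) (q ^+ 2) => x y x0 y0 xy.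
  have xN0 : x != 0 by apply: contra_eq_neq xy => ->; rewrite mul0r.
  have yN0 : y != 0 by apply: contra_eq_neq xy => ->; rewrite mulr0.
  have : 0 <= (x - 1) * (y - 1) by apply: mulr_ge0; lia.
  by rewrite mulrBl mulrBr xy; lia.
by rewrite mul1r.
Qed.

Lemma integral_basis_det (e : (\dim {:K}).-tuple K) :
    \dim {:K} = 3 -> integral_basis e ->
  \det (\matrix_(i, j) galTrace 1 {:K} (tnth e i * tnth e j)) = (N ^ 2)%:R.
Proof.
move=> dim3 [_ OE].
have Oe i : O (tnth e i).
  rewrite OE; exists (fun j => (j == i)%:Z).
  by rewrite (bigD1 i)//= eqxx mulr1z big1 ?addr0// => j /negPf->.
have Ov j : exists c, v j = \sum_i tnth e i *~ c i.
  have : O (v j).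
    by rewrite /v; case: j => [[|[|[|//]]] ?] //=; [case: Mm|apply: integers_conj; case: Mm].
  by rewrite OE => -[c cE]; exists c.
have /choice[C CE] i : exists c : 'I_3 -> int, tnth e i = \sum_j v j *~ c j.
  have [t [j [k ->]]] := integers_coord (Oe i).
  exists (fun l => [:: t; j; k]`_l).
  by rewrite !big_ord_recl big_ord0 /v /= addr0 addrA.
rewrite -[RHS](change_of_basis_det dim3 CE Ov).
by congr (\det _); apply/matrixP => i j; rewrite !mxE strace.
Qed.

Lemma exists_integral_basis n : n = \dim {:K} -> n = 3%N ->
  exists e : n.-tuple K, basis_of {:K} e /\
    @ring_of_integers K = [set x | exists c : 'I_n -> int, x = \sum_i (tnth e i) *~ c i].
Proof.
move=> ndim n3; move: ndim; rewrite {}n3 => dim3.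
exists [tuple b; m; s m]; split.
  rewrite basisEdim -[X in _ && X]/(3 <= \dim {:K})%N -dim3 andbT; apply/subvP => x _.
  have [q qE] := sfix (s_tr s3 x).
  have ty : tr (x - q *: b) = 0.
    have tq : tr (q *: b) = q *: tr b.
      by rewrite /conj_trace !scale_in_alg !(rmorphM s) !(s_in_alg s); ring.
    by rewrite trB tq trb qE subrr.
  have [_ tm] := Mm.
  have [u [w E]] := trace0_span s3 sfix tm mN0 ty.
  rewrite -[x](subrK (q *: b)) E; apply: memvD; first apply: memvD.
  - by apply/memvZ/memv_span; rewrite !inE eqxx orbT.
  - by apply/memvZ/memv_span; rewrite !inE eqxx !orbT.
  - by apply/memvZ/memv_span; rewrite !inE eqxx.
rewrite predeqE => x; split=> [/integers_coord[t [i [j ->]]]|[c ->]].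
  exists (fun l => [:: t; i; j]`_l).
  by rewrite !big_ord_recl big_ord0 !(tnth_nth 0) /= addr0 addrA.
rewrite !big_ord_recl big_ord0 !(tnth_nth 0) /=.
have [Om _] := Mm.
by do !apply: integersD; first [exact: integers0|apply: integersMz] => //; apply: integers_conj.
Qed.

(** [discriminant] selects some admissible value, so besides the existence of an integral basis it
    matters that all integral bases give the same determinant. *)
Lemma discriminantE : abelian_cubic K -> discriminant K = (N ^ 2)%:Z.
Proof.
case=> dim3 galK; have [e eB] := exists_integral_basis (erefl _) dim3.
have dU d : is_discriminant K d -> d = (N ^ 2)%:Z.
  case=> e' e'B; rewrite (integral_basis_det dim3 e'B) => dE.
  exact: (@intr_ext_inj K).
apply: dU; apply: (@xgetPex _ 0 (is_discriminant K)).
by exists (N ^ 2)%:Z, e => //; rewrite integral_basis_det.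
Qed.
End Discriminant.

(** * Cubic polynomials with root field K *)

Definition cubic (R : pzRingType) (a b : R) : R -> R := fun x => x ^+ 3 - x ^+ 2 + a * x + b.

Definition trace1_cubic (a b : int) : {poly int} := 'X^3 - 'X^2 + a *: 'X + b%:P.

Lemma size_trace1_cubic a b : size (trace1_cubic a b) = 4%N.
Proof.
rewrite /trace1_cubic -!addrA size_polyDl size_polyXn// ltnS.
apply: leq_trans (size_polyD _ _) _; rewrite geq_max size_polyN size_polyXn/=.
apply: leq_trans (size_polyD _ _) _; rewrite geq_max (leq_trans (size_scale_leq _ _)) ?size_polyX//=.
by rewrite (leq_trans (size_polyC_leq1 _)).
Qed.

Lemma trace1_cubic_monic a b : trace1_cubic a b \is monic.
Proof.
rewrite monicE /lead_coef size_trace1_cubic /trace1_cubic.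
by rewrite !(coefD, coefN, coefZ, coefXn, coefX, coefC) /=; apply/eqP; ring.
Qed.

Lemma coef_trace1_cubic a b :
  ((trace1_cubic a b)`_0 = b) * ((trace1_cubic a b)`_1 = a).
Proof.
by rewrite /trace1_cubic; split; rewrite !(coefD, coefN, coefZ, coefXn, coefX, coefC) /=; ring.
Qed.

Lemma horner_trace1_cubic (R : comNzRingType) (a b : int) (x : R) :
  (map_poly intr (trace1_cubic a b)).[x] = cubic a%:~R b%:~R x.
Proof.
rewrite /trace1_cubic !(rmorphD (map_poly intr), rmorphN (map_poly intr)) /=.
rewrite map_polyZ !map_polyXn map_polyX map_polyC /=.
by rewrite !(hornerD, hornerN, hornerZ, hornerXn, hornerX, hornerC).
Qed.

Lemma map_intr_in_alg (L : fieldExtType rat) (p : {poly int}) :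
  map_poly (in_alg L) (map_poly intr p) = map_poly intr p.
Proof. by rewrite -map_poly_comp; apply: eq_map_poly => n /=; rewrite in_alg_int. Qed.

Lemma qpoly_root (L : fieldExtType rat) (a b : int) :
    let h : {poly rat} := map_poly intr (trace1_cubic a b) in
  forall phi : {rmorphism {poly %/ h} -> L}, cubic a%:~R b%:~R (phi (in_qpoly h 'X)) = 0.
Proof.
move=> h phi; have hm : h \is monic by apply: monic_map; exact: trace1_cubic_monic.
have hs : size h = 4%N.
  by rewrite size_map_inj_poly ?size_trace1_cubic//; exact: intr_inj.
have h0 : in_qpoly h h = 0.
  by apply: val_inj => /=; rewrite /mk_monic hs hm /= Pdiv.RingMonic.rmodpp.
have hE : h = 'X^3 - 'X^2 + a%:~R * 'X + b%:~R.
  rewrite /h /trace1_cubic !(rmorphD (map_poly intr), rmorphN (map_poly intr)) /=.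
  rewrite map_polyZ !map_polyXn map_polyX map_polyC /=.
  by rewrite -mul_polyC !rmorph_int.
have : phi (in_qpoly h h) = 0 by rewrite h0 rmorph0.
rewrite [X in in_qpoly _ X]hE => <-; rewrite /cubic.
by ring.
Qed.

Section Cubics.
Variables (K : fieldExtType rat) (s : {rmorphism K -> K}).
Hypothesis s3 : forall x, s (s (s x)) = x.
Hypothesis sfix : forall x, s x = x -> exists q : rat, x = q%:A.
Implicit Types x y z m : K.
Local Notation O := (@ring_of_integers K).
Local Notation tr := (conj_trace s).
Local Notation nm := (conj_norm s).
Local Notation e2 := (conj_e2 s).
Local Notation qf := (conj_form s).

(** A polynomial of degree at most 2 with coefficients fixed by [s] that vanishes at [x] vanishes at
    three distinct conjugates; divided differences eliminate its coefficients one after another. *)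
Lemma quadratic_conj_eq0 x p q r : s x != x -> s p = p -> s q = q -> s r = r ->
  p * x ^+ 2 + q * x + r = 0 -> [/\ p = 0, q = 0 & r = 0].
Proof.
move=> sx sp sq sr E; have [sx2 sx3] := s_neq s3 sx.
have E1 : p * s x ^+ 2 + q * s x + r = 0.
  by rewrite -[RHS](rmorph0 s) -E !(rmorphD s) !(rmorphM s) !sp !sq !sr; ring.
have E2 : p * s (s x) ^+ 2 + q * s (s x) + r = 0.
  by rewrite -[RHS](rmorph0 s) -E1 !(rmorphD s) !(rmorphM s) !sp !sq !sr; ring.
have F1 : p * (x + s x) + q = 0.
  apply: (@mulfI _ (s x - x)); rewrite ?subr_eq0// mulr0 -(subrr 0) -{1}E1 -E; ring.
have F2 : p * (s x + s (s x)) + q = 0.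
  by apply: (@mulfI _ (s (s x) - s x)); rewrite ?subr_eq0// mulr0 -(subrr 0) -{1}E2 -E1; ring.
have p0 : p = 0.
  by apply: (@mulfI _ (s (s x) - x)); rewrite ?subr_eq0// mulr0 -(subrr 0) -{1}F2 -F1; ring.
by move: E F1; rewrite p0 !mul0r !add0r => + q0; rewrite q0 mul0r add0r.
Qed.

Lemma trace1_nfixed x : O x -> tr x = 1 -> s x != x.
Proof.
move=> Ox tx; apply/eqP => sx; have [n nE] := fixed_int sfix Ox sx.
move: tx; rewrite /conj_trace nE !rmorph_int -!intrD => /(@intr_ext_inj K (n + n + n) 1); lia.
Qed.

(** The difference between the given cubic and the characteristic polynomial of [x] is at most
    quadratic, has coefficients fixed by [s] and vanishes at [x], so it is zero. *)
Lemma root_field_conj x (a b : int) : s x != x -> cubic a%:~R b%:~R x = 0 ->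
  [/\ O x, tr x = 1, e2 x = a%:~R & nm x = (- b)%:~R].
Proof.
move=> sx x0.
have [] := @quadratic_conj_eq0 x (tr x - 1) (a%:~R - e2 x) (b%:~R + nm x) sx.
- by rewrite (rmorphB s) (s_tr s3) rmorph1.
- by rewrite (rmorphB s) (s_e2 s3) rmorph_int.
- by rewrite (rmorphD s) (s_nm s3) rmorph_int.
- by rewrite -(subrr 0) -{1}x0 -(charpolyE s x) /cubic; ring.
move=> /eqP; rewrite subr_eq0 => /eqP tx /eqP; rewrite subr_eq0 => /eqP ax.
move=> /eqP; rewrite addrC addr_eq0 => /eqP bx; split=> //; last by rewrite bx intrN.
apply: (@integral_cubic K x 1 a (- b)); rewrite -x0 /cubic; ring.
Qed.

(** The roots of the cubic are the conjugates of [x], none of them rational, so it is irreducible.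
    Evaluation at [x] is the isomorphism: interpolation makes it onto, and a remainder of degree at
    most 2 that vanishes at [x] is zero. *)
Lemma conj_root_field x (a b : int) : O x -> tr x = 1 -> e2 x = a%:~R -> nm x = (- b)%:~R ->
  has_root_field K (trace1_cubic a b).
Proof.
move=> Ox tx ax bx; rewrite /has_root_field; set h := map_poly _ _.
have sx := trace1_nfixed Ox tx; have [sx2 sx3] := s_neq s3 sx.
have cE y : cubic a%:~R b%:~R y = (y - x) * (y - s x) * (y - s (s x)).
  rewrite /cubic; transitivity (y ^+ 3 - tr x * y ^+ 2 + e2 x * y - nm x).
    by rewrite tx ax bx; ring.
  by rewrite /conj_trace /conj_e2 /conj_norm; ring.
have hm : h \is monic by apply: monic_map; exact: trace1_cubic_monic.
have hs : size h = 4%N.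
  by rewrite size_map_inj_poly ?size_trace1_cubic//; exact: intr_inj.
have mkE : mk_monic h = h by rewrite /mk_monic hs hm.
split.
  apply: cubic_irreducible; first by rewrite hs.
  move=> q; apply/negP; rewrite -(fmorph_root (in_alg K)) map_intr_in_alg /root.
  rewrite horner_trace1_cubic cE !mulf_eq0 !subr_eq0.
  have sq : s (in_alg K q) = in_alg K q by exact: s_in_alg.
  case/orP=> [/orP[]|] /eqP xq; move: sx; apply/negP; rewrite negbK.
  - by rewrite -xq sq.
  - by rewrite -(s3 x) -xq !sq.
  - by rewrite -(s3 x) -xq !sq.
pose ev (p : {poly rat}) := (map_poly (in_alg K) p).[x].
have evh : ev h = 0.
  by rewrite /ev map_intr_in_alg horner_trace1_cubic cE subrr !mul0r.
have evmod p : ev (Pdiv.Ring.rmodp p h) = ev p.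
  by rewrite {2}(Pdiv.RingMonic.rdivp_eq hm p) /ev rmorphD rmorphM hornerD hornerM -/(ev h) evh mulr0 add0r.
have evmk p : ev (Pdiv.Ring.rmodp p (mk_monic h)) = ev p by rewrite mkE evmod.
pose phi (p : {poly %/ h}) := ev p.
have phiD : zmod_morphism phi.
  by move=> p q; rewrite /phi /ev /= rmorphB hornerD hornerN.
have phiM : monoid_morphism phi.
  split=> [|p q]; first by rewrite /phi /ev /= rmorph1 hornerC.
  by rewrite /phi poly_of_qpolyM evmk /ev rmorphM hornerM.
pose phiA := GRing.isZmodMorphism.Build _ _ phi phiD.
pose phiB := GRing.isMonoidMorphism.Build _ _ phi phiM.
pose phiR : {rmorphism {poly %/ h} -> K} := HB.pack phi phiA phiB.
exists phiR.
(* Lagrange interpolation of s^i y at the conjugates s^i x. *)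
have surj y : exists p, phi p = y.
  pose l0 := y / ((x - s x) * (x - s (s x))).
  pose l1 := s y / ((s x - s (s x)) * (s x - x)).
  pose l2 := s (s y) / ((s (s x) - x) * (s (s x) - s x)).
  have sl0 : s l0 = l1 by rewrite /l0 /l1 fmorph_div !(rmorphM s) !(rmorphB s) s3.
  have sl1 : s l1 = l2 by rewrite /l2 /l1 fmorph_div !(rmorphM s) !(rmorphB s) s3.
  have sl2 : s l2 = l0 by rewrite /l2 /l0 fmorph_div !(rmorphM s) !(rmorphB s) !s3.
  have l0E : l0 * ((x - s x) * (x - s (s x))) = y.
    by rewrite /l0 mulfVK// mulf_neq0// subr_eq0 eq_sym.
  clearbody l0 l1 l2.
  have [c2 c2E] : exists q : rat, l0 + l1 + l2 = q%:A.
    by apply: sfix; rewrite !(rmorphD s) sl0 sl1 sl2; ring.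
  have [c1 c1E] : exists q : rat,
      - (l0 * (s x + s (s x)) + l1 * (s (s x) + x) + l2 * (x + s x)) = q%:A.
    apply: sfix; rewrite !(rmorphN s, rmorphD s) !(rmorphM s) !(rmorphD s) sl0 sl1 sl2 s3; ring.
  have [c0 c0E] : exists q : rat,
      l0 * (s x * s (s x)) + l1 * (s (s x) * x) + l2 * (x * s x) = q%:A.
    apply: sfix; rewrite !(rmorphD s) !(rmorphM s) sl0 sl1 sl2 s3; ring.
  exists (in_qpoly h (c2 *: 'X^2 + c1 *: 'X + c0%:P)).
  rewrite /phi /= evmk /ev !rmorphD /= !map_polyZ /= map_polyXn map_polyX map_polyC /=.
  rewrite !(hornerD, hornerZ, hornerXn, hornerX, hornerC) -c2E -c1E -c0E.
  by rewrite -[RHS]l0E; ring.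
have [g gK] : exists g, cancel g phi by have /choice[g gE] := surj; exists g.
exists g => // p.
have inj q : phi q = 0 -> q = 0.
  have smk : size (mk_monic h) = 4%N by rewrite mkE hs.
  have sq : (size q <= 3)%N by rewrite -ltnS -smk size_mk_monic.
  have qE : val q = q`_2 *: 'X^2 + q`_1 *: 'X + (q`_0)%:P.
    apply/polyP => i; rewrite !(coefD, coefZ, coefXn, coefX, coefC).
    case: i => [|[|[|i]]] /=; rewrite ?mulr0 ?mulr1 ?add0r ?addr0//.
    by rewrite nth_default// (leq_trans sq).
  rewrite /phi /ev qE !rmorphD /= !map_polyZ /= map_polyXn map_polyX map_polyC /=.
  rewrite !(hornerD, hornerZ, hornerXn, hornerX, hornerC).
  have sA c : s c%:A = c%:A by have := s_in_alg s c.
  case/(quadratic_conj_eq0 sx (sA _) (sA _) (sA _)).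
  rewrite -!(scale0r (1 : K)) => /in_alg_inj q2 /in_alg_inj q1 /in_alg_inj q0.
  by apply: val_inj; rewrite qE q2 q1 q0 !scale0r polyC0 !addr0.
apply/eqP; rewrite -subr_eq0; apply/eqP/inj.
by rewrite phiD gK subrr.
Qed.

Lemma trace_one_cubicsP f : trace_one_cubics K f <->
  exists x (a b : int), [/\ O x, tr x = 1, e2 x = a%:~R, nm x = (- b)%:~R & f = trace1_cubic a b].
Proof.
split=> [[[a [b fE]] hf]|[x [a [b [Ox tx ax bx ->]]]]]; last first.
  by split; [exists a, b|exact: conj_root_field Ox tx ax bx].
move: hf; rewrite /has_root_field fE -/(trace1_cubic a b) => -[irr [phi _]].
have x0 := qpoly_root phi; set x := phi _ in x0.
have sx : s x != x.
  apply/eqP => /sfix[q xq].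
  have : root (map_poly intr (trace1_cubic a b)) q.
    rewrite -(fmorph_root (in_alg K)) map_intr_in_alg /root horner_trace1_cubic.
    by move: x0; rewrite xq => /eqP.
  rewrite -dvdp_XsubCl => dv; have [_ /(_ _ _ dv)] := irr.
  rewrite size_XsubC => /(_ isT)/eqp_size.
  by rewrite size_XsubC size_map_inj_poly ?size_trace1_cubic//; exact: intr_inj.
by have [? ? ? ?] := root_field_conj sx x0; exists x, a, b.
Qed.

Lemma qf_diff x : tr x = 1 -> qf (s x - x) = 1 - 3%:R * e2 x.
Proof.
move=> tx; transitivity (tr x ^+ 2 - 3%:R * e2 x); last by rewrite tx; ring.
by rewrite /conj_form /conj_trace /conj_e2 !(rmorphB s); ring.
Qed.

Lemma cubic_coef1_le0 f : trace_one_cubics K f -> f`_1 <= 0.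
Proof.
move=> /trace_one_cubicsP[x [a [b [Ox tx ax bx ->]]]]; rewrite coef_trace1_cubic.
have Mx : trace0_integers s (s x - x).
  by split; [apply: integersB => //; exact: integers_conj|rewrite trB (tr_s s3) subrr].
have dN0 : s x - x != 0 by rewrite subr_eq0 trace1_nfixed.
have [n n0] := trace0_form_nat s3 sfix Mx dN0.
rewrite qf_diff// ax => E.
have : 1 - 3 * a = n by apply: (@intr_ext_inj K); rewrite -[RHS]E; ring.
lia.
Qed.
End Cubics.

(* Pairs (u, v) stand for u + v omega with omega^2 + omega + 1 = 0; eis_rot is
   multiplication by omega. *)
Definition eis_rot (z : int * int) : int * int := (- z.2, z.1 - z.2).

(* u + v omega = u + v modulo 1 - omega, an associate of sqrt(-3). *)
Definition one_mod_sqrtm3 (z : int * int) := (3 %| z.1 + z.2 - 1)%Z.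

(** * Integers of trace 1 and Eisenstein integers congruent to 1 modulo sqrt(-3) *)

Section Parametrization.
Variables (K : fieldExtType rat) (s : {rmorphism K -> K}).
Hypothesis s3 : forall x, s (s (s x)) = x.
Hypothesis sfix : forall x, s x = x -> exists q : rat, x = q%:A.
Implicit Types x y : K.
Local Notation O := (@ring_of_integers K).
Local Notation tr := (conj_trace s).
Local Notation nm := (conj_norm s).
Local Notation e2 := (conj_e2 s).
Local Notation qf := (conj_form s).
Local Notation M := (trace0_integers s).
Variables (b m : K) (N : nat).
Hypotheses (Ob : O b) (trb : tr b = 1) (Mm : M m) (mN0 : m != 0) (sb : s b = b + m).
Hypothesis mB : forall x, M x -> exists a c : int, x = m *~ a + s m *~ c.
Hypothesis qfm : qf m = N%:R.

Let tm : tr m = 0. Proof. by case: Mm. Qed.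

(** For x = b + (c + d omega) m one has s(x) - x = (1 + (omega - 1)(c + d omega)) m, so the
    coordinates fill the residue class of 1 modulo 1 - omega; the next lemma inverts this. *)
Lemma trace1_coord x : O x -> tr x = 1 ->
  exists2 z : int * int, one_mod_sqrtm3 z & s x - x = m *~ z.1 + s m *~ z.2.
Proof.
move=> Ox tx; have [c [d cd]] : exists c d : int, x - b = m *~ c + s m *~ d.
  by apply: mB; split; [exact: integersB|rewrite trB tx trb subrr].
exists (1 - c - d, c - 2 * d); first by apply/dvdz3P; exists (- d) => /=; lia.
have -> : x = b + (m *~ c + s m *~ d) by rewrite -cd; ring.
by rewrite !(rmorphD s) sb !rmorphMz (tr0_ss tm) /=; ring.
Qed.

Lemma trace1_of_coord z : one_mod_sqrtm3 z ->
  exists x, [/\ O x, tr x = 1 & s x - x = m *~ z.1 + s m *~ z.2].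
Proof.
case: z => u v /dvdz3P[k /= kE]; pose d := - k; pose c := v + 2 * d.
have Mcd : M (m *~ c + s m *~ d) by apply: trace0D => //; apply: trace0Mz => //; apply: trace0_conj.
exists (b + (m *~ c + s m *~ d)); split.
- by apply: integersD => //; case: Mcd.
- by rewrite trD trb; case: Mcd => _ ->; rewrite addr0.
- have -> : u = 1 - c - d by rewrite /c /d; lia.
  have -> : v = c - 2 * d by rewrite /c; lia.
  by rewrite !(rmorphD s) sb !rmorphMz (tr0_ss tm) /=; ring.
Qed.

(** The difference x - y is fixed by [s] and has trace 0, so 3 (x - y) = 0. *)
Lemma trace1_inj x y : tr x = 1 -> tr y = 1 -> s x - x = s y - y -> x = y.
Proof.
move=> tx ty E; have E2 : s (s x) - s x = s (s y) - s y by rewrite -!(rmorphB s) E.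
apply/eqP; rewrite -subr_eq0.
have : 3%:R * (x - y) == 0.
  have -> : 3%:R * (x - y) = (tr x - tr y) + ((s y - y) - (s x - x))
     + ((s (s y) - s y) + (s y - y) - (s (s x) - s x) - (s x - x)).
    by rewrite /conj_trace; ring.
  by rewrite tx ty E E2; apply/eqP; ring.
by rewrite mulf_eq0 (negPf (alg_natrN0 _ _)).
Qed.

Lemma rot_coord z : s (m *~ z.1 + s m *~ z.2) = m *~ (eis_rot z).1 + s m *~ (eis_rot z).2.
Proof. by rewrite rmorphD !rmorphMz (tr0_ss tm) /=; ring. Qed.

Definition cubic_of (z : int * int) (f : {poly int}) : Prop :=
  exists x (a c : int), [/\ O x, tr x = 1, s x - x = m *~ z.1 + s m *~ z.2,
    e2 x = a%:~R & nm x = (- c)%:~R] /\ f = trace1_cubic a c.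

Lemma cubic_param : exists F : int * int -> {poly int},
  [/\ (forall z, one_mod_sqrtm3 z -> trace_one_cubics K (F z)),
      (forall f, trace_one_cubics K f -> exists2 z, one_mod_sqrtm3 z & F z = f),
      (forall z z', one_mod_sqrtm3 z -> one_mod_sqrtm3 z' ->
         F z = F z' <-> [\/ z' = z, z' = eis_rot z | z' = eis_rot (eis_rot z)])
    & (forall z, one_mod_sqrtm3 z -> 1 - 3 * (F z)`_1 = eis_norm z.1 z.2 * N%:Z)].
Proof.
have /choice[F FP] z : exists f, one_mod_sqrtm3 z -> cubic_of z f.
  have [hz|] := boolP (one_mod_sqrtm3 z); last by exists 0.
  have [x [Ox tx xz]] := trace1_of_coord hz.
  have [a aE] := e2_int s3 sfix Ox; have [c cE] := nm_O_int s3 sfix Ox.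
  by exists (trace1_cubic a (- c)) => _; exists x, a, (- c); rewrite opprK.
exists F; split.
- move=> z /FP[x [a [c [[Ox tx _ ax cx] ->]]]].
  by apply/(trace_one_cubicsP s3 sfix); exists x, a, c.
- move=> f /(trace_one_cubicsP s3 sfix)[x [a [c [Ox tx ax cx ->]]]].
  have [z hz zE] := trace1_coord Ox tx; exists z => //.
  have [y [a' [c' [[Oy ty yz ay cy] ->]]]] := FP _ hz.
  have xy : x = y by apply: trace1_inj => //; rewrite zE.
  rewrite xy ay in ax; rewrite xy cy in cx.
  by move: ax cx => /intr_ext_inj -> /intr_ext_inj /oppr_inj ->.
- move=> z z' hz hz'.
  have [x [a [c [[Ox tx xz ax cx] ->]]]] := FP _ hz.
  have [y [a' [c' [[Oy ty yz ay cy] ->]]]] := FP _ hz'.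
  have sxz : s (s x) - s x = m *~ (eis_rot z).1 + s m *~ (eis_rot z).2.
    by rewrite -(rmorphB s) xz rot_coord.
  have ssxz : s (s (s x)) - s (s x) =
      m *~ (eis_rot (eis_rot z)).1 + s m *~ (eis_rot (eis_rot z)).2.
    by rewrite -(rmorphB s) sxz rot_coord.
  have coord (w w' : int * int) : m *~ w.1 + s m *~ w.2 = m *~ w'.1 + s m *~ w'.2 -> w = w'.
    by case: w w' => [? ?] [? ?] /(trace0_coord_inj s3 sfix tm mN0)/= [-> ->].
  split=> [E|h].
    have aa : a = a' by have := congr1 (fun f : {poly int} => f`_1) E; rewrite !coef_trace1_cubic.
    have cc : c = c' by have := congr1 (fun f : {poly int} => f`_0) E; rewrite !coef_trace1_cubic.
    (* [y] is a root of the characteristic polynomial of [x], hence a conjugate of [x]; passing to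
       [s x] rotates the coordinates. *)
    have : (y - x) * (y - s x) * (y - s (s x)) = 0.
      transitivity (y ^+ 3 - tr x * y ^+ 2 + e2 x * y - nm x).
        by rewrite /conj_trace /conj_e2 /conj_norm; ring.
      by rewrite tx ax cx aa cc -ay -cy -ty charpolyE.
    move=> /eqP; rewrite !mulf_eq0 !subr_eq0 => /orP[/orP[]|] /eqP yE.
    + by apply: Or31; apply: coord; rewrite -xz -yz yE.
    + by apply: Or32; apply: coord; rewrite -sxz -yz yE.
    + by apply: Or33; apply: coord; rewrite -ssxz -yz yE.
  have [y2 [yE e2E nmE]] : exists y2, [/\ y = y2, e2 y2 = e2 x & nm y2 = nm x].
    case: h => zE; rewrite zE in yz.
    + by exists x; split=> //; apply: trace1_inj => //; rewrite xz.
    + exists (s x); split; last 2 first.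
      * by rewrite /conj_e2 s3; ring.
      * by rewrite /conj_norm s3; ring.
      * by apply: trace1_inj => //; rewrite ?(tr_s s3) ?sxz.
    + exists (s (s x)); split; last 2 first.
      * by rewrite /conj_e2 !s3; ring.
      * by rewrite /conj_norm !s3; ring.
      * by apply: trace1_inj => //; rewrite ?(tr_s s3) ?ssxz.
  move: ay cy; rewrite yE e2E nmE ax cx.
  by move=> /intr_ext_inj -> /intr_ext_inj /oppr_inj ->.
- move=> z hz; have [x [a [c [[Ox tx xz ax cx] ->]]]] := FP _ hz.
  rewrite coef_trace1_cubic; apply: (@intr_ext_inj K).
  transitivity (1 - 3%:R * e2 x); first by rewrite ax; ring.
  by rewrite -(qf_diff tx) xz qfMz// qfm intrM.
Qed.
End Parametrization.

Theorem trace_one_cubics_param (K : splittingFieldType rat) :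
    abelian_cubic K -> tamely_ramified K ->
  exists2 N : nat, (0 < N)%N /\ discriminant K = (N ^ 2)%:Z &
  exists F : int * int -> {poly int},
  [/\ (forall z, one_mod_sqrtm3 z -> trace_one_cubics K (F z)),
      (forall f, trace_one_cubics K f -> exists2 z, one_mod_sqrtm3 z & F z = f),
      (forall z z', one_mod_sqrtm3 z -> one_mod_sqrtm3 z' ->
         F z = F z' <-> [\/ z' = z, z' = eis_rot z | z' = eis_rot (eis_rot z)])
    & (forall z, one_mod_sqrtm3 z -> 1 - 3 * (F z)`_1 = eis_norm z.1 z.2 * N%:Z)].
Proof.
move=> cubK tameK; have [s [s3 sfix sN1 strace]] := abelian_cubic_generator cubK.
have tr1 := tame_trace1 s3 sfix sN1 tameK.
have [b [m [[Ob tb Mm mN0 sb] mB]]] := trace1_basis s3 sfix sN1 tr1.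
have [N N0 NE] := trace0_form_nat s3 sfix Mm mN0.
exists N; last exact: (cubic_param s3 sfix Ob tb Mm mN0 sb mB NE).
split=> //; exact: (discriminantE s3 sfix strace Ob tb Mm mN0 sb mB NE cubK).
Qed.

(** * Ideals of the Eisenstein integers *)

Definition eis_mul (z w : int * int) : int * int :=
  (z.1 * w.1 - z.2 * w.2, z.1 * w.2 + z.2 * w.1 - z.2 * w.2).

(** From here on the field is handled only through an embedding into [algC] and a square root [r] of
    -3 that spans it together with 1. *)
Lemma Qsqrtm3_generator : exists (phi : {rmorphism Qsqrtm3 -> algC}) (r : Qsqrtm3),
  phi r = sqrtC (-3) /\ forall x, exists a b : rat, x = a%:A + b%:A * r.
Proof.
rewrite /Qsqrtm3; case: (num_field_exists _) => L [phi [[|r [|//]] //= [rE] Lr]].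
exists phi, r; split=> // x.
have r2 : r ^+ 2 = - 3%:R.
  apply: (fmorph_inj phi); rewrite rmorphXn /= rE sqrtCK.
  by rewrite rmorphN rmorph_nat.
have : x \in <<1; r>>%VS by rewrite -adjoin_seq1 Lr memvf.
move=> /Fadjoin_polyP[p /polyOver1P[q ->] ->] {x}.
elim/poly_ind: q => [|q c [a [b E]]].
  by exists 0, 0; rewrite rmorph0 horner0 !scale0r mul0r addr0.
exists (-3 * b + c), a; rewrite rmorphD rmorphM /= map_polyX map_polyC /=.
rewrite !hornerE E -!in_algE; transitivity (in_alg L b * r ^+ 2 + in_alg L a * r + in_alg L c).
  by ring.
by rewrite r2; ring.
Qed.

Section Eisenstein.
Variables (L : fieldExtType rat) (phi : {rmorphism L -> algC}) (r : L).
Hypothesis phir : phi r = sqrtC (-3).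
Hypothesis span : forall x, exists a b : rat, x = a%:A + b%:A * r.
Implicit Types x y : L.
Local Notation O := (@ring_of_integers L).

Lemma sqrtm3_sq : r ^+ 2 = -3%:R.
Proof.
apply: (fmorph_inj phi); rewrite rmorphXn /= phir sqrtCK.
by rewrite rmorphN rmorph_nat.
Qed.

Let t : algC := sqrtC (-3).

Lemma conj_sqrtm3 : t^* = - t.
Proof.
have t2 : t ^+ 2 = -3 by exact: sqrtCK.
have : (t^* - t) * (t^* + t) = 0.
  by transitivity ((t ^+ 2)^* - t ^+ 2); [rewrite rmorphXn; ring|rewrite t2 rmorphN rmorph_nat subrr].
move=> /eqP; rewrite mulf_eq0 => /orP[|]; last by rewrite addr_eq0 => /eqP.
rewrite subr_eq0 -CrealE => tR; have := real_exprn_even_ge0 tR (n := 2) isT.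
by rewrite t2 oppr_ge0 lern0.
Qed.

Definition eis_omega : L := (r - 1) / 2%:R.

Lemma two_neq0 : 2%:R != 0 :> L. Proof. exact: alg_natrN0. Qed.

Lemma omega_sq : eis_omega ^+ 2 = - 1 - eis_omega.
Proof.
have := two_neq0 => n2; apply: (@mulfI _ (2%:R ^+ 2)); first by rewrite expf_neq0.
transitivity (r ^+ 2 - 2%:R * r + 1); first by rewrite /eis_omega; field.
by rewrite sqrtm3_sq /eis_omega; field.
Qed.

Lemma sqrtm3E : r = 1 + 2%:R * eis_omega.
Proof. by rewrite /eis_omega; have := two_neq0 => n2; field. Qed.

Lemma span_omega x : exists a b : rat, x = a%:A + b%:A * eis_omega.
Proof.
have [a [b ->]] := span x; exists (a + b), (2 * b).
by rewrite -!in_algE [X in _ * X]sqrtm3E; ring.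
Qed.

Definition eis_ev (z : int * int) : L := z.1%:~R + z.2%:~R * eis_omega.

Lemma ev_mul z w : eis_ev (eis_mul z w) = eis_ev z * eis_ev w.
Proof.
transitivity (z.1%:~R * w.1%:~R + (z.1%:~R * w.2%:~R + z.2%:~R * w.1%:~R) * eis_omega
   + z.2%:~R * w.2%:~R * eis_omega ^+ 2 : L); last by rewrite /eis_ev; ring.
by rewrite omega_sq /eis_ev /=; ring.
Qed.

Lemma integral_omega : O eis_omega.
Proof.
exists ('X^2 + 'X + 1).
  rewrite monicE -addrA lead_coefDl ?lead_coefXn// size_polyXn -[1]/(1%:P).
  by rewrite size_XaddC.
rewrite /root !rmorphD /= map_polyXn map_polyX rmorph1.
by rewrite !(hornerD, hornerXn, hornerX, hornerC) omega_sq; apply/eqP; ring.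
Qed.

Lemma ev_integral z : O (eis_ev z).
Proof. by apply: integersD; [exact: integers_int|apply: integersM; [exact: integers_int|exact: integral_omega]]. Qed.

Lemma integral_Aint x : O x -> phi x \in Aint.
Proof.
case=> p pm rt; apply: (@root_monic_Aint (map_poly intr p)).
- have -> : map_poly (intr : int -> algC) p = map_poly phi (map_poly intr p).
    by rewrite -map_poly_comp; apply: eq_map_poly => n /=; rewrite rmorph_int.
  by rewrite fmorph_root.
- exact: monic_map.
- by apply/polyOverP => i; rewrite coef_map /= intr_int.
Qed.

Lemma phi_alg (q : rat) : phi q%:A = ratr q.
Proof. by rewrite alg_num_field fmorph_rat. Qed.

Lemma Aint_ratr_int (q : rat) : ratr q \in Aint -> exists n : int, q = n%:~R.
Proof.
move=> /(Cint_rat_Aint (Crat_rat q))/intrP[n nE]; exists n.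
by apply: (fmorph_inj (@ratr algC)); rewrite /= nE ratr_int.
Qed.

(** For x = a + b sqrt(-3), the trace 2 a, the norm a^2 + 3 b^2 and (conj x - x) sqrt(-3) = 6 b are
    rational algebraic integers. The relation 12 W = 3 U^2 + k^2 between them first gives 3 | k, so
    that 2 b is an integer V, and then that U and V have the same parity; the coordinates are (U +
    V) / 2 and V. *)
Lemma integral_ev x : O x -> exists z, x = eis_ev z.
Proof.
move=> Ox; have [a [b xE]] := span x; have Ax := integral_Aint Ox.
have phix : phi x = ratr a + ratr b * t by rewrite xE rmorphD rmorphM !phi_alg phir.
have cx : (phi x)^* = ratr a - ratr b * t.
  rewrite phix (rmorphD Num.conj) (rmorphM Num.conj (ratr b) t) /= conj_sqrtm3.
  by rewrite !conj_Crat ?Crat_rat// mulrN.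
have Acx : (phi x)^* \in Aint by rewrite (Aint_aut Num.conj).
have t2 : t ^+ 2 = -3 by exact: sqrtCK.
have At : t \in Aint.
  rewrite /t -phir; apply: integral_Aint; rewrite sqrtm3E.
  by apply: integersD; [exact: integers1|apply: integersM; [exact: integers_nat|exact: integral_omega]].
have [U UE] : exists n : int, 2 * a = n%:~R.
  apply: Aint_ratr_int; have -> : ratr (2 * a) = phi x + (phi x)^* :> algC.
    by rewrite cx phix; ring.
  exact: rpredD.
have [k kE] : exists n : int, 3 * (2 * b) = n%:~R.
  apply: Aint_ratr_int; have -> : ratr (3 * (2 * b)) = ((phi x)^* - phi x) * t :> algC.
    transitivity (- 2%:R * ratr b * t ^+ 2 : algC); first by rewrite t2; ring.
    by rewrite cx phix; ring.
  by rewrite rpredM ?rpredB.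
have [W WE] : exists n : int, a ^+ 2 + 3 * b ^+ 2 = n%:~R.
  apply: Aint_ratr_int; have -> : ratr (a ^+ 2 + 3 * b ^+ 2) = phi x * (phi x)^* :> algC.
    rewrite cx phix; transitivity (ratr a ^+ 2 - ratr b ^+ 2 * t ^+ 2 : algC); last by ring.
    by rewrite t2; ring.
  exact: rpredM.
have E : 12 * W = 3 * U ^+ 2 + k ^+ 2.
  apply: (@intr_inj rat); transitivity (12 * W%:~R : rat); first by ring.
  rewrite -WE; transitivity (3 * (2 * a) ^+ 2 + (3 * (2 * b)) ^+ 2); first by field.
  by rewrite UE kE; ring.
have /dvdz3P[V VE] : (3 %| k)%Z.
  by rewrite -(@dvdz3X _ 1); apply/dvdz3P; exists (4 * W - U ^+ 2); lia.
have bE : 2 * b = V%:~R.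
  by apply: (@mulfI rat 3) => //; rewrite kE VE intrM.
have E2 : 4 * W = U ^+ 2 + 3 * V ^+ 2 by move: E; rewrite VE; lia.
have [u uE] : exists u, U + V = 2 * u.
  have h (n : int) : exists q, n = 2 * q \/ n = 2 * q + 1.
    have := divz_eq n 2; set q := (_ %/ _)%Z; set d := (_ %% _)%Z => Eq.
    have d0 : 0 <= d by apply: modz_ge0.
    have d2 : d < 2 by apply: ltz_pmod.
    by exists q; lia.
  have [u [uE|uE]] := h U; have [v [vE|vE]] := h V.
  - by exists (u + v); lia.
  - by exfalso; move: E2; rewrite uE vE => E2; lia.
  - by exfalso; move: E2; rewrite uE vE => E2; lia.
  - by exists (u + v + 1); lia.
exists (u, V); rewrite xE /eis_ev /= -!in_alg_int -bE.
have -> : u%:~R = a + b.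
  apply: (@mulfI rat 2) => //; rewrite mulrDr UE bE -intrD uE; ring.
by rewrite -!in_algE [X in _ + _ * X = _]sqrtm3E; ring.
Qed.
End Eisenstein.

Definition eis_conj (z : int * int) : int * int := (z.1 - z.2, - z.2).
Definition eis_opp (z : int * int) : int * int := (- z.1, - z.2).
Definition eis_nm (z : int * int) : int := eis_norm z.1 z.2.

Lemma eis_nm_mul z w : eis_nm (eis_mul z w) = eis_nm z * eis_nm w.
Proof. by rewrite /eis_nm /eis_norm /eis_mul /=; ring. Qed.

Lemma eis_nm_ge0 z : 0 <= eis_nm z.
Proof.
have : 0 <= 4 * eis_nm z.
  have -> : 4 * eis_nm z = (2 * z.1 - z.2) ^+ 2 + 3 * z.2 ^+ 2 by rewrite /eis_nm /eis_norm; ring.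
  by apply: addr_ge0; [|apply: mulr_ge0 => //]; apply: sqr_ge0.
lia.
Qed.

Lemma eis_nm_gt0 z : z != (0, 0) -> 0 < eis_nm z.
Proof.
move=> zN0; rewrite lt_neqAle eis_nm_ge0 andbT eq_sym; apply: contraNneq zN0.
by case: z => a b /eis_norm_eq0[/= -> ->].
Qed.

Lemma eis_mulA z w v : eis_mul z (eis_mul w v) = eis_mul (eis_mul z w) v.
Proof. by rewrite /eis_mul /=; congr (_, _); ring. Qed.

Lemma eis_mul1 z : eis_mul z (1, 0) = z.
Proof. by case: z => a b; rewrite /eis_mul /=; congr (_, _); ring. Qed.

Lemma eis_mul_conj z : eis_mul z (eis_conj z) = (eis_nm z, 0).
Proof. by rewrite /eis_mul /eis_nm /eis_norm /=; congr (_, _); ring. Qed.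

Lemma eis_unitP u : eis_nm u = 1 ->
  u = (1, 0) \/ u = (0, 1) \/ u = (-1, -1) \/ u = (-1, 0) \/ u = (0, -1) \/ u = (1, 1).
Proof.
case: u => a b; rewrite /eis_nm /eis_norm /= => E.
have b1 : -1 <= b <= 1 by nia.
have a1 : -1 <= a <= 1 by nia.
have [aE|[aE|aE]] : a = -1 \/ a = 0 \/ a = 1 by lia.
all: have [bE|[bE|bE]] : b = -1 \/ b = 0 \/ b = 1 by lia.
all: move: E; rewrite aE bE => E; first [by []|by left|by right; left|by do 2!right; left|by do 3!right; left|by do 4!right; left|by do 5!right|exfalso; lia].
Qed.

Definition eis_assoc (z w : int * int) : Prop := exists2 u, eis_nm u = 1 & w = eis_mul z u.

(** The six units are grouped by sign: powers of omega preserve the residue class modulo sqrt(-3),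
    and their opposites negate it. *)
Lemma eis_assocE z w : eis_assoc z w <->
  [\/ w = z, w = eis_rot z | w = eis_rot (eis_rot z)] \/
  [\/ w = eis_opp z, w = eis_opp (eis_rot z) | w = eis_opp (eis_rot (eis_rot z))].
Proof.
case: z => a b; split.
  move=> [u /eis_unitP uE ->]; rewrite /eis_mul /eis_rot /eis_opp /=.
  case: uE => [->|[->|[->|[->|[->|->]]]]] /=.
  - by left; apply: Or31; congr (_, _); ring.
  - by left; apply: Or32; congr (_, _); ring.
  - by left; apply: Or33; congr (_, _); ring.
  - by right; apply: Or31; congr (_, _); ring.
  - by right; apply: Or32; congr (_, _); ring.
  - by right; apply: Or33; congr (_, _); ring.
case=> [[]|[]] ->; rewrite /eis_assoc /eis_mul /eis_rot /eis_opp /=.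
- by exists (1, 0) => //=; congr (_, _); ring.
- by exists (0, 1) => //=; congr (_, _); ring.
- by exists (-1, -1) => //=; congr (_, _); ring.
- by exists (-1, 0) => //=; congr (_, _); ring.
- by exists (0, -1) => //=; congr (_, _); ring.
- by exists (1, 1) => //=; congr (_, _); ring.
Qed.

Section EisensteinIdeals.
Variables (L : fieldExtType rat) (phi : {rmorphism L -> algC}) (r : L).
Hypothesis phir : phi r = sqrtC (-3).
Hypothesis span : forall x, exists a b : rat, x = a%:A + b%:A * r.
Implicit Types x y : L.
Local Notation O := (@ring_of_integers L).
Local Notation omega := (eis_omega r).
Local Notation ev := (eis_ev r).

Let nrm x : algC := phi x * (phi x)^*.

Lemma nrm_span (a b : rat) : nrm (a%:A + b%:A * omega) = ratr (eis_norm a b).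
Proof.
have t2 : (sqrtC (-3) : algC) ^+ 2 = -3 by exact: sqrtCK.
have phiw : phi (a%:A + b%:A * omega) = ratr (a - b / 2) + ratr (b / 2) * sqrtC (-3).
  rewrite rmorphD rmorphM !phi_alg /eis_omega fmorph_div rmorphB rmorph1 rmorph_nat phir.
  by field.
have conjw : (phi (a%:A + b%:A * omega))^* = ratr (a - b / 2) - ratr (b / 2) * sqrtC (-3).
  rewrite phiw (rmorphD Num.conj) (rmorphM Num.conj (ratr (b / 2)) _) /= conj_sqrtm3.
  by rewrite !conj_Crat ?Crat_rat// mulrN.
rewrite /nrm conjw phiw.
transitivity (ratr (a - b / 2) ^+ 2 - ratr (b / 2) ^+ 2 * sqrtC (-3) ^+ 2 : algC); first by ring.
rewrite t2; transitivity (ratr ((a - b / 2) ^+ 2 + 3 * (b / 2) ^+ 2) : algC); first by ring.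
by congr (ratr _); rewrite /eis_norm; field.
Qed.

Lemma nrm_ev z : nrm (ev z) = (eis_nm z)%:~R.
Proof.
rewrite /ev -!in_alg_int nrm_span -[RHS]ratr_int; congr (ratr _).
by rewrite /eis_nm /eis_norm; ring.
Qed.

Lemma nrmM x y : nrm (x * y) = nrm x * nrm y.
Proof. by rewrite /nrm !rmorphM /=; ring. Qed.

Lemma evB z w : ev z - ev w = ev (z.1 - w.1, z.2 - w.2).
Proof. by rewrite /eis_ev /=; ring. Qed.

Lemma ev0 : ev (0, 0) = 0.
Proof. by rewrite /eis_ev /= mul0r addr0. Qed.

Lemma ev_inj z w : ev z = ev w -> z = w.
Proof.
case: z w => [a b] [c d] E; have := nrm_ev (a - c, b - d).
rewrite -(evB (a, b) (c, d)) E subrr /nrm rmorph0 mul0r => /esym/eqP.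
by rewrite intr_eq0 => /eqP /eis_norm_eq0[/= h1 h2]; congr (_, _); lia.
Qed.

Lemma ev_neq0 z : z != (0, 0) -> ev z != 0.
Proof. by apply: contraNneq => h; apply/eqP/ev_inj; rewrite h ev0. Qed.

Definition eis_ideal z : set L := principal_ideal (ev z).

Lemma eis_idealP z x : eis_ideal z x <-> exists w, x = ev (eis_mul z w).
Proof.
split=> [[y /(integral_ev phir span)[w ->] <-]|[w ->]].
  by exists w; rewrite (ev_mul phir).
by exists (ev w); [exact: ev_integral phir w|rewrite (ev_mul phir)].
Qed.

Lemma eis_ideal_is_ideal z : is_ideal (eis_ideal z).
Proof.
have Oez : O (ev z) by exact: ev_integral phir z.
split=> [_ [x Ox <-]||_ _ [x Ox <-] [y Oy <-]|a _ Oa [x Ox <-]].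
- exact: integersM.
- by exists 0; [exact: integers0|rewrite mulr0].
- by exists (x + y); [exact: integersD|rewrite mulrDr].
- by exists (a * x); [exact: integersM|rewrite mulrCA].
Qed.

Lemma eis_ideal_nonzero z : z != (0, 0) -> nonzero_ideals (eis_ideal z).
Proof.
move=> zN0; split; first exact: eis_ideal_is_ideal.
apply/eqP => I0; have : eis_ideal z (ev z) by exists 1; [exact: integers1|rewrite mulr1].
by rewrite I0 => /eqP; rewrite (negPf (ev_neq0 zN0)).
Qed.

(** Two generators of one ideal divide each other, and the norms of the two cofactors are
    nonnegative integers with product 1. *)
Lemma eis_ideal_assoc z w : z != (0, 0) -> eis_ideal z = eis_ideal w <-> eis_assoc z w.
Proof.
move=> zN0; split=> [E|[u u1 ->]].
  have [v wE] : exists v, ev w = ev (eis_mul z v).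
    by apply/eis_idealP; rewrite E; exists 1; [exact: integers1|rewrite mulr1].
  have [v' zE] : exists v', ev z = ev (eis_mul w v').
    by apply/eis_idealP; rewrite -E; exists 1; [exact: integers1|rewrite mulr1].
  move: wE zE => /ev_inj wE /ev_inj zE; exists v => //.
  have h : eis_nm z * (eis_nm v * eis_nm v') = eis_nm z * 1.
    by rewrite mulrA -!eis_nm_mul -wE -zE mulr1.
  have := eis_nm_gt0 zN0; move: h (eis_nm_ge0 v) (eis_nm_ge0 v').
  move: (eis_nm z) (eis_nm v) (eis_nm v') => n p q h p0 q0 n0.
  have {}h : p * q = 1 by move: h => /mulfI; apply; lia.
  have pN0 : p != 0 by apply: contra_eq_neq h => ->; rewrite mul0r.
  have qN0 : q != 0 by apply: contra_eq_neq h => ->; rewrite mulr0.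
  have : 0 <= (p - 1) * (q - 1) by apply: mulr_ge0; lia.
  by rewrite mulrBl mulrBr h; lia.
rewrite predeqE => x; split=> /eis_idealP[v ->]; apply/eis_idealP.
  exists (eis_mul (eis_conj u) v); congr (ev _).
  by rewrite eis_mulA -(eis_mulA z) eis_mul_conj u1 eis_mul1.
by exists (eis_mul u v); rewrite eis_mulA.
Qed.

(** The Euclidean lemma applied to multiplication by omega and to the norm, whose rational value [Q]
    extracts. *)
Lemma ideal_principal J : nonzero_ideals J -> exists2 z, z != (0, 0) & J = eis_ideal z.
Proof.
case=> idJ JN0; have [JO J0 JD JM] := idJ.
have JN x : J x -> J (- x).
  by rewrite -mulN1r; apply: JM; apply: integersN; exact: integers1.
pose Q x : rat := xget 0 [set q | nrm x = ratr q].
have QE x : nrm x = ratr (Q x).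
  have [a [b ->]] := span_omega span x.
  apply: (@xgetPex _ 0 [set q | _ = ratr q]).
  by exists (eis_norm a b); rewrite /= nrm_span.
have nrm0 x : nrm x = 0 -> x = 0.
  by rewrite /nrm => /eqP; rewrite mulf_eq0 conjC_eq0 orbb fmorph_eq0 => /eqP.
have [m [Jm mN0 mJ]] : exists m, [/\ J m, m != 0 &
    forall x, J x -> exists a b : int, x = m *~ a + (omega * m) *~ b].
  apply: (@eis_module_cyclic _ (fun x => omega * x) J Q) => //.
  - by move=> x y Jx Jy; apply: JD => //; apply: JN.
  - by move=> x; apply: JM; exact: integral_omega phir.
  - move=> m a b _; apply: (fmorph_inj (@ratr algC)); rewrite rmorphM /= -!QE -nrm_span -nrmM.
    by congr (nrm _); rewrite !scale_in_alg; ring.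
  - move=> x Jx; have [z xz] := integral_ev phir span (JO _ Jx).
    have [n nE] : exists n : nat, eis_nm z = n by exists `|eis_nm z|%N; have := eis_nm_ge0 z; lia.
    exists n; apply: (fmorph_inj (@ratr algC)); rewrite /= -QE xz nrm_ev nE.
    by rewrite ratr_nat.
  - move=> x _; apply: contraNneq => Q0; apply/eqP/nrm0.
    by rewrite QE Q0 rmorph0.
  - move=> m x _ mN0 _; have [a [b ab]] := span_omega span (x / m).
    exists a, b; rewrite !scale_in_alg -[LHS](mulfVK mN0) ab -!in_algE; ring.
  - apply: contrapT => no; move: JN0; apply/negP/negPn/eqP.
    rewrite predeqE => x; split=> [Jx|-> //]; apply: contrapT => xN0; apply: no.
    by exists x => //; apply/eqP.
have [z mz] := integral_ev phir span (JO _ Jm).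
exists z; first by apply: contraNneq mN0 => z0; rewrite mz z0 ev0.
rewrite predeqE => x; split=> [/mJ[a [b ->]]|[y Oy <-]].
  apply/eis_idealP; exists (a, b); rewrite (ev_mul phir) -mz /eis_ev /=; ring.
by rewrite mulrC -mz; apply: JM.
Qed.
End EisensteinIdeals.

(* Hermite form of the lattice z Z[omega] in the basis 1, omega: it is spanned by
   (h, 0) and (c, g). *)
Lemma eis_lattice_hermite z : z != (0, 0) -> exists (g h : nat) (c : int),
  [/\ (0 < g)%N, (0 < h)%N, eis_nm z = (h * g)%N &
    [/\ exists v, eis_mul z v = (c, g%:Z),
        exists v, eis_mul z v = (h%:Z, 0),
        forall v, (g %| (eis_mul z v).2)%Z
      & forall v, (eis_mul z v).2 = 0 -> (h %| (eis_mul z v).1)%Z]].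
Proof.
case: z => a b zN0; have n0 := eis_nm_gt0 zN0.
have [p [q pq]] := Bezoutz a b.
have [/dvdzP[a' aE] /dvdzP[b' bE]] := (dvdz_gcdl a b, dvdz_gcdr a b).
pose g := `|gcdz a b|%N; have gE : gcdz a b = g by rewrite /g gez0_abs// .
rewrite gE in pq aE bE.
have g0 : (0 < g)%N.
  by rewrite lt0n; apply: contraNneq zN0 => g0; rewrite aE bE g0 !mulr0.
have pq1 : p * a' + q * b' = 1.
  apply: (@mulIf _ g%:Z); first by rewrite -lt0n.
  by rewrite mul1r -[RHS]pq [in RHS]aE [in RHS]bE; ring.
(* With z = g z', this is z times the conjugate of z'; it will turn out to generate the rational
   integers in the ideal of z. *)
pose hz := g%:Z * eis_norm a' b'.
have nE : eis_nm (a, b) = hz * g by rewrite /eis_nm /hz /eis_norm /= aE bE; ring.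
have hz0 : 0 < hz by rewrite nE pmulr_lgt0// ltz_nat in n0.
pose h := `|hz|%N; have hE : hz = h by rewrite /h; lia.
exists g, h, ((eis_mul (a, b) (q + p, p)).1); split=> //.
- by rewrite /h absz_gt0; lia.
- by rewrite nE hE PoszM.
split.
- by exists (q + p, p); rewrite /eis_mul /= -[in RHS]pq; congr (_, _); ring.
- exists (a' - b', - b'); rewrite -hE /eis_mul /= aE bE /hz /eis_norm.
  by congr (_, _); ring.
- move=> [v1 v2]; rewrite /eis_mul /= aE bE; apply/dvdzP.
  by exists (a' * v2 + b' * v1 - b' * v2); ring.
- move=> [v1 v2]; rewrite /eis_mul /= => E; apply/dvdzP.
  (* The vanishing second coordinate makes a' x and b' x multiples of [hz], and x = (p a' + q b') x
     by Bezout; the witness collects the two quotients. *)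
  set x := _ - _; exists (p * (v1 - v2) - q * v2).
  have E' : a' * v2 + b' * v1 - b' * v2 = 0.
    apply: (@mulIf _ g%:Z); first by rewrite -lt0n.
    by rewrite mul0r -[RHS]E aE bE; ring.
  have xb : - b' * x = hz * v2.
    transitivity (- b' * x + g%:Z * a' * (a' * v2 + b' * v1 - b' * v2)); first by rewrite E'; ring.
    by rewrite /x /hz /eis_norm aE bE; ring.
  have xa : a' * x = hz * (v1 - v2).
    transitivity (a' * x - g%:Z * (a' - b') * (a' * v2 + b' * v1 - b' * v2)); first by rewrite E'; ring.
    by rewrite /x /hz /eis_norm aE bE; ring.
  rewrite -hE; transitivity ((p * a' + q * b') * x); first by rewrite pq1 mul1r.
  transitivity (p * (a' * x) - q * (- b' * x)); first by ring.
  by rewrite xa xb; ring.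
Qed.

Lemma coset_eq (L : fieldExtType rat) (I : set L) x y : is_ideal I ->
  [set x + z | z in I] = [set y + z | z in I] <-> I (x - y).
Proof.
move=> [IO I0 ID IM].
have IN z : I z -> I (- z) by rewrite -mulN1r; apply: IM; apply: integersN; exact: integers1.
split=> [E|xy].
  have : [set y + z | z in I] x by rewrite -E; exists 0; rewrite ?addr0.
  by case=> z Iz <-; rewrite addrC addKr.
rewrite predeqE => w; split=> [[z Iz <-]|[z Iz <-]].
  by exists (x - y + z); [exact: ID|ring].
by exists (- (x - y) + z); [apply: ID => //; exact: IN|ring].
Qed.

Section IdealNorm.
Variables (L : fieldExtType rat) (phi : {rmorphism L -> algC}) (r : L).
Hypothesis phir : phi r = sqrtC (-3).
Hypothesis span : forall x, exists a b : rat, x = a%:A + b%:A * r.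
Local Notation ev := (eis_ev r).

(** The Hermite basis gives the coset representatives i + j omega with 0 <= i < h and 0 <= j < g;
    they are numbered by k = i g + j. *)
Lemma ideal_norm_eis z : z != (0, 0) -> (ideal_norm (eis_ideal r z))%:Z = eis_nm z.
Proof.
move=> zN0; have [g [h [c [g0 h0 nE [[v1 v1E] [v2 v2E] gdvd hdvd]]]]] := eis_lattice_hermite zN0.
have idI := eis_ideal_is_ideal phir z.
rewrite nE; congr Posz; rewrite /ideal_norm; apply: card_fset_set.
rewrite card_eq_sym; apply/card_set_bijP.
pose rep k : int * int := ((k %/ g)%N%:Z, (k %% g)%N%:Z).
exists (fun k => [set ev (rep k) + y | y in eis_ideal r z]).
split=> [k _|k l|].
- by exists (ev (rep k)) => //; exact: ev_integral phir _.
- rewrite !inE /= => kn ln /(coset_eq _ _ idI).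
  rewrite evB => /(eis_idealP phir span)[v /(ev_inj phir)[E1 E2]].
  have := gdvd v; rewrite /eis_mul /= -E2 => /dvdzP[q qE].
  have kg : (k %% g < g)%N by rewrite ltn_mod.
  have lg : (l %% g < g)%N by rewrite ltn_mod.
  have q0 : q = 0 by nia.
  have kl : (k %% g = l %% g)%N by move: qE; rewrite q0; lia.
  have := hdvd v; rewrite /eis_mul /= -E2 -E1 kl subrr => /(_ erefl)/dvdzP[p pE].
  have kh : (k %/ g < h)%N by rewrite ltn_divLR.
  have lh : (l %/ g < h)%N by rewrite ltn_divLR.
  have p0 : p = 0 by nia.
  rewrite (divn_eq k g) (divn_eq l g) kl; congr (_ * _ + _)%N.
  by move: pE; rewrite p0; lia.
- move=> _ [x Ox <-]; have [[a b] xE] := integral_ev phir span Ox.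
  have ghE := divz_eq b g; set q := (b %/ g)%Z in ghE; set j := (b %% g)%Z in ghE.
  have j0 : 0 <= j by apply: modz_ge0; lia.
  have jg : j < g%:Z by apply: ltz_pmod; lia.
  pose a1 := a - q * c; have hE := divz_eq a1 h.
  set p := (a1 %/ h)%Z in hE; set i := (a1 %% h)%Z in hE.
  have i0 : 0 <= i by apply: modz_ge0; lia.
  have ih : i < h%:Z by apply: ltz_pmod; lia.
  have [jn jE] : exists n : nat, j = n by exists `|j|%N; lia.
  have [m mE] : exists n : nat, i = n by exists `|i|%N; lia.
  have jgn : (jn < g)%N by lia.
  have mh : (m < h)%N by lia.
  exists (m * g + jn)%N => /=; first by nia.
  apply/coset_eq => //; rewrite xE evB /rep /= divnMDl// divn_small// addn0.
  rewrite modnMDl modn_small// -mE -jE; apply/(eis_idealP phir span).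
  exists (- q * v1.1 - p * v2.1, - q * v1.2 - p * v2.2); congr (eis_ev r _).
  have -> : eis_mul z (- q * v1.1 - p * v2.1, - q * v1.2 - p * v2.2) =
    (- q * (eis_mul z v1).1 - p * (eis_mul z v2).1, - q * (eis_mul z v1).2 - p * (eis_mul z v2).2).
    by rewrite /eis_mul /=; congr (_, _); ring.
  rewrite v1E v2E /= ghE; congr (_, _); last by ring.
  have -> : a = q * c + (p * h + i) by rewrite -hE /a1; ring.
  by ring.
Qed.
End IdealNorm.

(** * Unconditional sums of complex numbers *)

Lemma eq_cvg_to (T : Type) (V : topologicalType) (F : set_system T) (f g : T -> V) (l : V) :
  f @ F --> l -> f =1 g -> g @ F --> l.
Proof. by move=> h /funext <-. Qed.

Section ComplexSums.
Variable R : realType.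
Local Notation C := R[i].

Lemma lt0_complexE (e : C) : 0 < e -> exists2 d : R, 0 < d & e = d%:C%C.
Proof.
case: e => a b; rewrite ltcE /= => /andP[/eqP b0 a0]; exists a => //.
by rewrite b0.
Qed.

Lemma normc_real (x : R) : `|x%:C%C : C| = `|x|%:C%C.
Proof. by rewrite normc_def /= expr0n /= addr0 sqrtr_sqr. Qed.

Lemma abs_Re_le (z : C) : `|complex.Re z| <= complex.Re `|z|.
Proof.
by rewrite normc_def /= -sqrtr_sqr ler_wsqrtr// lerDl sqr_ge0.
Qed.

Lemma abs_Im_le (z : C) : `|complex.Im z| <= complex.Re `|z|.
Proof.
by rewrite normc_def /= -sqrtr_sqr ler_wsqrtr// lerDr sqr_ge0.
Qed.

Lemma Re_norm_ge0 (z : C) : 0 <= complex.Re `|z|.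
Proof. exact: le_trans (normr_ge0 _) (abs_Re_le z). Qed.

Lemma Re_normM (c z : C) : complex.Re `|c * z| = complex.Re `|c| * complex.Re `|z|.
Proof. by rewrite normrM !normc_def /= mul0r subr0. Qed.

Variable T : choiceType.
Implicit Types (D : set T) (f : T -> C) (g : T -> R).

Let psum (f : T -> C) : {fset T} -> C^o := @summability.partial_sum T C^o f.
Local Notation totally := (@summability.totally T).
#[local] Existing Instance summability.totally_filter.
Let FF : Filter totally. Proof. exact: filter_filter. Qed.

Lemma partial_sum_patchE (V : zmodType) (A : {fset T}) D (f : T -> V) :
  summability.partial_sum (patch (fun=> 0) D f) A
    = \sum_(x \in [set x | x \in A /\ D x]) f x.
Proof.
have finA : finite_set [set x | x \in A /\ D x].
  by apply: (@sub_finite_set _ _ [set` A]) => [x []|]; [|exact: finite_fset].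
rewrite /summability.partial_sum fsbig_finite//.
rewrite -(big_seq_fsetE _ _ predT (patch (fun=> 0) D f)) /=.
rewrite (bigID (fun x => x \in D)) /= [X in _ + X]big1 ?addr0; last first.
  by move=> x /negPf xD; rewrite /patch xD.
rewrite [RHS](_ : _ = \sum_(x <- [fset x in A | x \in D]%fset) f x); last first.
  apply: perm_big; apply: uniq_perm; rewrite ?fset_uniq// => x.
  rewrite in_fset_set// !inE /=.
  by apply/idP/andP => [/set_mem[-> xD]|[xA xD]]; [rewrite mem_set|apply/mem_set; split => //; exact: set_mem].
by rewrite big_fset /=; apply: eq_bigr => x; rewrite /patch => ->.
Qed.

(** The extended sum is a supremum over finite subsets: once a finite set comes within d of it, so
    does every larger one. *)
Lemma nneg_psum_cvg D g : (forall x, 0 <= g x) -> (\esum_(x in D) (g x)%:E < +oo)%E ->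
  psum (patch (fun=> 0) D (fun x => (g x)%:C%C)) @ totally -->
    ((fine (\esum_(x in D) (g x)%:E))%:C%C : C^o).
Proof.
move=> g0 fin; set S := \esum_(x in D) _ in fin *.
have S0 : (0 <= S)%E by apply: esum_ge0 => x _; rewrite lee_fin.
have SE : S = (fine S)%:E by rewrite fineK// ge0_fin_numE.
have finA (A : {fset T}) : finite_set [set x | x \in A /\ D x].
  by apply: (@sub_finite_set _ _ [set` A]) => [x []|]; [|exact: finite_fset].
have psE A : psum (patch (fun=> 0) D (fun x => (g x)%:C%C)) A =
    (\sum_(x \in [set x | x \in A /\ D x]) g x)%:C%C.
  by rewrite /psum partial_sum_patchE !fsbig_finite// rmorph_sum.
have psub (A : {fset T}) : \sum_(x \in [set x | x \in A /\ D x]) g x <= fine S.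
  rewrite -lee_fin -SE; apply: esum_ge; exists [set x | x \in A /\ D x].
    by split=> // x [].
  by rewrite -fsumEFin.
apply/(@cvgrPdist_lt C C^o) => e /lt0_complexE[d d0 ->{e}].
have [|y [X [finX XD] <-] dy] := @ereal_sup_gt R
    [set (\sum_(x \in A) (g x)%:E)%R | A in fsets D] (S - d%:E).
  rewrite -/S; rewrite [ltRHS](_ : _ = S)// SE -EFinB lte_fin; lra.
exists (fset_set X) => // B /= XB.
rewrite psE -rmorphB /= normc_real ltcR ger0_norm ?subr_ge0// ltrBlDr -ltrBlDl.
move: dy; rewrite SE -EFinB fsumEFin// lte_fin => /lt_le_trans; apply.
rewrite -lee_fin -!fsumEFin//; apply: lee_fsum_nneg_subset => //.
  move=> x; rewrite !inE => Xx; split; last exact: XD.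
  by move/fsubsetP: XB; apply; rewrite in_fset_set// inE.
by move=> x _; rewrite lee_fin.
Qed.

Definition re_pos f x : R := Num.max (complex.Re (f x)) 0.
Definition im_pos f x : R := Num.max (complex.Im (f x)) 0.
Definition rsum D g : R := fine (\esum_(x in D) (g x)%:E).

(** Four nonnegative sums, the positive and negative parts of the real and imaginary parts. In this
    form reindexing along a bijection is inherited from [esum]. *)
Definition csum_val D f : C :=
  ((rsum D (re_pos f) - rsum D (re_pos (fun x => - f x)))
   +i* (rsum D (im_pos f) - rsum D (im_pos (fun x => - f x))))%C.

Lemma abs_summable_fin D f g : abs_summable D f ->
  (forall x, 0 <= g x <= complex.Re `|f x|) -> (\esum_(x in D) (g x)%:E < +oo)%E.
Proof.
move=> sf gf; apply: le_lt_trans sf; apply: le_esum => x _.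
have /andP[g0 gle] := gf x.
by rewrite lee_fin (le_trans gle)// ler_norm.
Qed.

Lemma csum_cvg D f : abs_summable D f ->
  psum (patch (fun=> 0) D f) @ totally --> (csum_val D f : C^o).
Proof.
move=> sf.
have posP (u v : R) : `|u| <= v -> 0 <= Num.max u 0 <= v.
  by move=> uv; rewrite le_max lexx orbT ge_max (le_trans (ler_norm _) uv) (le_trans _ uv).
have rep x : 0 <= re_pos f x <= complex.Re `|f x| by apply: posP; exact: abs_Re_le.
have imp x : 0 <= im_pos f x <= complex.Re `|f x| by apply: posP; exact: abs_Im_le.
have ren x : 0 <= re_pos (fun x => - f x) x <= complex.Re `|f x|.
  by apply: posP; have := abs_Re_le (- f x); rewrite normrN.
have imn x : 0 <= im_pos (fun x => - f x) x <= complex.Re `|f x|.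
  by apply: posP; have := abs_Im_le (- f x); rewrite normrN.
have cv g : (forall x, 0 <= g x <= complex.Re `|f x|) ->
    psum (patch (fun=> 0) D (fun x => (g x)%:C%C)) @ totally --> ((rsum D g)%:C%C : C^o).
  by move=> gf; apply: nneg_psum_cvg; [move=> x; case/andP: (gf x)|exact: abs_summable_fin gf].
have h := cvgD (cvgB (cv _ rep) (cv _ ren)) (cvgZl_tmp (k := 'i%C : C) (cvgB (cv _ imp) (cv _ imn))).
have -> : csum_val D f = ((rsum D (re_pos f))%:C%C - (rsum D (re_pos (fun x => - f x)))%:C%C)
  + 'i%C * ((rsum D (im_pos f))%:C%C - (rsum D (im_pos (fun x => - f x)))%:C%C).
  by rewrite /csum_val; apply/eqP; rewrite eq_complex /=; apply/andP; split; apply/eqP; ring.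
have {}h := h FF FF FF FF; apply: (@eq_cvg_to _ C^o _ _ _ _ h) => A.
rewrite !fctE /= /psum /summability.partial_sum -!sumrB scaler_sumr -big_split /=.
apply: eq_bigr => x _; rewrite /patch; case: ifP => _; last by rewrite !subrr scaler0 addr0.
have maxB (u : R) : u = Num.max u 0 - Num.max (- u) 0.
  by case: (lerP 0 u) => u0; case: (lerP 0 (- u)); lra.
rewrite /re_pos /im_pos; case: (f (val x)) => u v /=.
apply/eqP; rewrite eq_complex /=; apply/andP; split; apply/eqP.
  by rewrite [RHS]maxB; ring.
by rewrite [RHS]maxB; ring.
Qed.

Lemma csumE D f : abs_summable D f -> csum D f = csum_val D f.
Proof.
move=> /csum_cvg h; apply: (@cvg_lim C^o) => //; exact: norm_hausdorff.
Qed.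

Lemma csum_unique D f (v : C) :
  psum (patch (fun=> 0) D f) @ totally --> (v : C^o) -> csum D f = v.
Proof. by move=> h; apply: (@cvg_lim C^o) => //; exact: norm_hausdorff. Qed.

Lemma eq_abs_summable D f (g : T -> C) : (forall x, D x -> f x = g x) ->
  abs_summable D f -> abs_summable D g.
Proof.
move=> fg; rewrite /abs_summable /summable => h; rewrite (eq_esum (b := fun x => `|(complex.Re `|f x|)%:E|%E))//.
by move=> x Dx; rewrite fg.
Qed.

Lemma eq_csum D f (g : T -> C) : (forall x, D x -> f x = g x) -> csum D f = csum D g.
Proof.
move=> fg; rewrite /csum; suff -> : patch (fun=> 0) D f = patch (fun=> 0) D g by [].
by apply/funext => x; rewrite /patch; case: ifP => // /set_mem/fg.
Qed.

Lemma abs_summableZ D f (c : C) : abs_summable D f -> abs_summable D (fun x => c * f x).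
Proof.
move=> sf; have finS : \esum_(x in D) `|(complex.Re `|f x|)%:E|%E \is a fin_num.
  by rewrite ge0_fin_numE// esum_ge0.
set S := esum _ _ in finS.
apply: (@le_lt_trans _ _ (complex.Re `|c| * fine S)%:E); last exact: ltry.
have c0 : 0 <= complex.Re `|c| by exact: Re_norm_ge0.
apply: ge_ereal_sup => _ [X [finX XD] <-].
have -> : \sum_(x \in X) `|(complex.Re `|c * f x|)%:E|%E
    = (complex.Re `|c| * \sum_(x \in X) complex.Re `|f x|)%:E.
  rewrite EFinM -fsumEFin// !fsbig_finite// ge0_sume_distrr; last first.
    by move=> x _; rewrite lee_fin Re_norm_ge0.
  apply: eq_bigr => x _; rewrite -EFinM; congr (_%:E).
  by rewrite ger0_norm ?Re_norm_ge0// Re_normM.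
rewrite lee_fin ler_wpM2l// -lee_fin fineK// -fsumEFin//.
apply: esum_ge; exists X => //; apply: lee_fsum => // x _.
by rewrite lee_fin ler_norm.
Qed.

Lemma csumZ D f (c : C) : abs_summable D f -> csum D (fun x => c * f x) = c * csum D f.
Proof.
move=> sf; apply: csum_unique; rewrite csumE//.
have h := cvgZl_tmp (k := c) (csum_cvg sf); have {}h := h FF; apply: (@eq_cvg_to _ C^o _ _ _ _ h) => A.
rewrite -[LHS]/(c *: psum (patch (fun=> 0) D f) A) /psum /summability.partial_sum scaler_sumr; apply: eq_bigr => x _.
by rewrite /patch; case: ifP => _; rewrite ?scaler0.
Qed.

Lemma abs_summable_sub D E f : D `<=` E -> abs_summable E f -> abs_summable D f.
Proof.
move=> DE; apply: le_lt_trans; apply: ereal_sup_le => _ [X [finX XD] <-].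
by exists X => //; split=> //; apply: subset_trans DE.
Qed.

Lemma csumU D E f : D `&` E = set0 -> abs_summable (D `|` E) f ->
  csum (D `|` E) f = csum D f + csum E f.
Proof.
move=> DE sf.
have sD := abs_summable_sub (@subsetUl _ D E) sf.
have sE := abs_summable_sub (@subsetUr _ D E) sf.
apply: csum_unique; rewrite !csumE//.
have h := cvgD (csum_cvg sD) (csum_cvg sE); have {}h := h FF; apply: (@eq_cvg_to _ C^o _ _ _ _ h) => A.
rewrite fctE /psum /summability.partial_sum -big_split; apply: eq_bigr => x _ /=.
rewrite /patch in_setU; case: ifPn => xD; case: ifPn => xE; rewrite ?addr0 ?add0r//=.
suff : (D `&` E) (val x) by rewrite DE.
by split; apply: set_mem.
Qed.
End ComplexSums.

Section Reindex.
Variables (R : realType) (T T' : choiceType) (D : set T) (E : set T') (h : T -> T').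
Variable f : T' -> R[i].
Hypothesis hbij : set_bij D E h.

Lemma abs_summable_reindex : abs_summable D (f \o h) <-> abs_summable E f.
Proof.
by rewrite /abs_summable /summable (reindex_esum _ _ _ _ hbij).
Qed.

Lemma csum_reindex : abs_summable E f -> csum D (f \o h) = csum E f.
Proof.
move=> sE; rewrite !csumE//; last by rewrite abs_summable_reindex.
by rewrite /csum_val /rsum !(reindex_esum _ _ _ _ hbij).
Qed.
End Reindex.

(** * Complex powers and convergence *)

Section Cpow.
Variable R : realType.
Implicit Types (x y : R) (s : R[i]).

Lemma cpowM x y s : 0 < x -> 0 < y -> cpow (x * y) s = cpow x s * cpow y s.
Proof.
move=> x0 y0; rewrite /cpow lnM ?posrE// !mulrDr expRD cosD sinD.
by apply/eqP; rewrite eq_complex /=; apply/andP; split; apply/eqP; ring.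
Qed.

Lemma norm_cpow x s : `|cpow x s| = (expR (complex.Re s * ln x))%:C%C.
Proof.
rewrite /cpow normrM normc_real (ger0_norm (expR_ge0 _)) normc_def /=.
by rewrite cos2Dsin2 sqrtr1 mulr1.
Qed.

Lemma cpowN x s : cpow x s * cpow x (- s) = 1.
Proof.
case: s => a b; rewrite /cpow /= !mulNr cosN sinN expRN.
have := cos2Dsin2 (b * ln x); have := expR_gt0 (a * ln x).
set e := expR _; set c := cos _; set d := sin _ => e0 cd.
have eN0 : e != 0 by rewrite gt_eqF.
apply/eqP; rewrite eq_complex /=; apply/andP; split; apply/eqP; last by ring.
by rewrite -[RHS]cd; field.
Qed.

Lemma cpow_sqrt x s : 0 < x -> cpow (Num.sqrt x) (- (2 * s)) = cpow x (- s).
Proof.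
move=> x0; have lnE : ln x = 2 * ln (Num.sqrt x).
  rewrite -{1}(sqr_sqrtr (ltW x0)) expr2 lnM ?posrE ?sqrtr_gt0//; ring.
case: s => a b; rewrite /cpow lnE /=.
by congr (_%:C%C * (cos _ +i* sin _)%C); [congr expR| |]; ring.
Qed.
End Cpow.

(** * Absolute convergence for Re s > 1 *)

Section Summability.
Variable R : realType.
Variable sigma : R.
Hypothesis sigma1 : 1 < sigma.

Let u (n : nat) : R := expR (- sigma * ln n.+1%:R).

(** Condensation: as [u n] stands for (n + 1)^(-sigma), both [u (2 * k).+1] and [u (2 * k).+2] are
    at most 2^(-sigma) [u k], which yields a recursion with ratio c = 2^(1 - sigma) < 1. *)
Lemma dirichlet_partial_sum_bound : exists C : R, forall n, \sum_(k < n) u k <= C.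
Proof.
have l2 : 0 < ln (2 : R) by rewrite ln_gt0// ltr1n.
pose c := 2 * expR (- sigma * ln 2).
have c0 : 0 < c by rewrite mulr_gt0// expR_gt0.
have c1 : c < 1.
  have -> : c = expR ((1 - sigma) * ln 2).
    by rewrite /c mulrBl mul1r mulNr expRD lnK// posrE.
  by rewrite expR_lt1 pmulr_llt0// subr_lt0.
have uS k : u (2 * k).+1 = expR (- sigma * ln 2) * u k.
  rewrite /u -expRD -mulrDr -lnM ?posrE ?ltr0n//; congr (expR (_ * ln _)).
  by rewrite -natrM; congr (_%:R); lia.
have uS2 k : u (2 * k).+2 <= expR (- sigma * ln 2) * u k.
  rewrite -uS /u ler_expR ler_nM2l ?oppr_lt0 ?(lt_trans _ sigma1)//.
  by rewrite ler_ln ?posrE ?ltr0n// ler_nat.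
(* This recursion makes 1 / (1 - c) a bound by strong induction. *)
have half N : \sum_(k < (2 * N).+1) u k <= 1 + c * \sum_(k < N) u k.
  elim: N => [|N IHN].
    by rewrite big_ord_recl !big_ord0 mulr0 !addr0 /u ln1 mulr0 expR0.
  have -> : ((2 * N.+1).+1 = (2 * N).+3)%N by lia.
  rewrite big_ord_recr big_ord_recr [in leRHS]big_ord_recr /= uS.
  have := uS2 N; rewrite /c in IHN *; lra.
have C0 : 0 < 1 - c by lra.
exists ((1 - c)^-1) => n; elim/ltn_ind: n => -[|n] IHn.
  by rewrite big_ord0 invr_ge0 ltW.
have mono m p : (m <= p)%N -> \sum_(k < m) u k <= \sum_(k < p) u k.
  move=> /subnKC <-; rewrite big_split_ord /= lerDl sumr_ge0// => i _.
  exact: expR_ge0.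
have le2 : (n.+1 <= (2 * n.+1./2).+1)%N by have := odd_double_half n.+1; case: odd; lia.
apply: (le_trans (mono _ _ le2)); apply: (le_trans (half _)).
have /IHn hn : (n.+1./2 < n.+1)%N by lia.
rewrite -[leRHS](_ : 1 + c * (1 - c)^-1 = _); first by rewrite lerD2l ler_pM2l.
by field; lra.
Qed.

Lemma esum_le_bound (T : choiceType) (D : set T) (a : T -> \bar R) (M : \bar R) :
  (forall X : set T, finite_set X -> X `<=` D -> (\sum_(x \in X) a x <= M)%E) ->
  (\esum_(x in D) a x <= M)%E.
Proof. by move=> h; apply: ge_ereal_sup => _ [X [finX XD] <-]; apply: h. Qed.

Lemma esum_pair_fin :
  (\esum_(x in [set: nat * nat]) (u x.1 * u x.2)%:E < +oo)%E.
Proof.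
have [C CP] := dirichlet_partial_sum_bound.
have u0 n : 0 <= u n by exact: expR_ge0.
have C0 : 0 <= C by apply: le_trans (CP 0%N); rewrite big_ord0.
have sumC (X : set nat) : finite_set X -> \sum_(k \in X) u k <= C.
  move=> finX; rewrite -lee_fin -fsumEFin//.
  have h : (\esum_(k in [set: nat]) (u k)%:E <= C%:E)%E.
    rewrite -nneseries_esumT; last by move=> n; rewrite lee_fin.
    apply: lime_le; first by apply: is_cvg_nneseries => n _ _; rewrite lee_fin.
    by apply: nearW => n; rewrite sumEFin lee_fin big_mkord.
  by apply: le_trans h; apply: esum_ge; exists X.
have -> : [set: nat * nat] = [set: nat] `*`` (fun=> [set: nat]).
  by rewrite predeqE => x; split.
rewrite -(esum_esum (a := fun i j => (u i * u j)%:E)); last by move=> i j; rewrite lee_fin mulr_ge0.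
apply: (@le_lt_trans _ _ (C * C)%:E); last exact: ltry.
apply: esum_le_bound => X finX _.
apply: (@le_trans _ _ (\sum_(i \in X) (u i * C)%:E)%E).
  apply: lee_fsum => // i _; apply: esum_le_bound => Y finY _.
  rewrite fsumEFin// lee_fin; have := sumC _ finY.
  by rewrite !fsbig_finite// -mulr_sumr => h; rewrite ler_wpM2l.
rewrite fsumEFin// lee_fin; have := sumC _ finX.
by rewrite !fsbig_finite// -mulr_suml => h; rewrite ler_wpM2r.
Qed.

(** For nonzero pairs (a + 1)(b + 1) is at most four times the norm of a + b omega, so each term is
    at most 4^sigma times a term of a product of two convergent series. *)
Lemma eis_abs_summable (s : R[i]) : complex.Re s = sigma ->
  abs_summable [set x : nat * nat | x != (0%N, 0%N)]
    (fun x => cpow (eis_nm (x.1%:Z, x.2%:Z))%:~R (- s)).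
Proof.
move=> sE; rewrite /abs_summable /summable.
pose k := expR (sigma * ln 4).
have k0 : 0 < k by exact: expR_gt0.
apply: (@le_lt_trans _ _ (\esum_(x in [set: nat * nat]) (k * (u x.1 * u x.2))%:E)%E).
  apply: (@le_trans _ _ (\esum_(x in [set x : nat * nat | x != (0%N, 0%N)]) (k * (u x.1 * u x.2))%:E)%E).
    apply: le_esum => -[a b] ab0.
    rewrite -[leLHS]/(`|(complex.Re `|cpow (eis_nm (a%:Z, b%:Z))%:~R (- s)|)%:E|)%E.
    rewrite norm_cpow (_ : complex.Re (- s) = - sigma); last by rewrite -sE; case: (s).
    rewrite /= lee_fin ger0_norm ?expR_ge0//.
    have zN0 : (a%:Z, b%:Z) != (0, 0) by apply: contraNneq ab0 => -[-> ->].
    have n0 := eis_nm_gt0 zN0.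
    rewrite /k /u -!expRD ler_expR -mulrDr.
    have ineq : (a.+1%:R * b.+1%:R : R) <= 4 * (eis_nm (a%:Z, b%:Z))%:~R.
      have : (a.+1%:Z * b.+1%:Z) <= 4 * eis_nm (a%:Z, b%:Z).
        have aa : a%:Z <= a%:Z ^+ 2 by nia.
        have bb : b%:Z <= b%:Z ^+ 2 by nia.
        have ab : 0 <= (a%:Z - b%:Z) ^+ 2 by exact: sqr_ge0.
        have -> : (a.+1%:Z * b.+1%:Z) = 1 + a%:Z + b%:Z + a%:Z * b%:Z.
          by rewrite !intS; ring.
        (* The four summands are at least 1, a + b, a b and 0 respectively. *)
        have -> : 4 * eis_nm (a%:Z, b%:Z) = eis_nm (a%:Z, b%:Z) + (a%:Z ^+ 2 + b%:Z ^+ 2)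
            + a%:Z * b%:Z + 2 * (a%:Z - b%:Z) ^+ 2 by rewrite /eis_nm /eis_norm /=; ring.
        lia.
      by rewrite -(ler_int R) !intrM.
    have : ln (a.+1%:R * b.+1%:R : R) <= ln (4 * (eis_nm (a%:Z, b%:Z))%:~R).
      by rewrite ler_ln// posrE ?mulr_gt0 ?ltr0n ?ltr0z.
    rewrite !lnM ?posrE ?ltr0n ?ltr0z// => h.
    have s0 : 0 <= sigma by apply: ltW; apply: lt_trans sigma1.
    by have := ler_wpM2l s0 h; lra.
  apply: esum_le_bound => X finX XD; apply: esum_ge; exists X => //.
have := esum_pair_fin; set E := esum _ _ => finE.
apply: (@le_lt_trans _ _ (k * fine E)%:E); last exact: ltry.
apply: esum_le_bound => X finX _.
rewrite fsumEFin// lee_fin fsbig_finite//= -mulr_sumr ler_pM2l//.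
rewrite -fsbig_finite// -lee_fin fineK; last first.
  by rewrite ge0_fin_numE//; apply: esum_ge0 => x _; rewrite lee_fin mulr_ge0 ?expR_ge0.
by rewrite -fsumEFin//; apply: esum_ge; exists X.
Qed.
End Summability.

(** * The identity of Dirichlet series *)

Lemma eis_assoc_sym z w : eis_assoc z w -> eis_assoc w z.
Proof.
move=> [u u1 ->]; exists (eis_conj u).
  by rewrite -u1 /eis_nm /eis_norm /=; ring.
by rewrite -eis_mulA eis_mul_conj u1 eis_mul1.
Qed.

(** Nonnegative coordinates describe the sector of 120 degrees between 1 and omega, while the units
    turn by multiples of 60 degrees. *)
Lemma eis_assoc_sector z : exists x : nat * nat, eis_assoc z (x.1%:Z, x.2%:Z).
Proof.
case: z => a b.
have nat_ge0 (n : int) : 0 <= n -> exists k : nat, n = k by move=> n0; exists `|n|%N; lia.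
suff [w [w1 w2 aw]] : exists w : int * int, [/\ 0 <= w.1, 0 <= w.2 & eis_assoc (a, b) w].
  have [[k kE] [l lE]] := (nat_ge0 _ w1, nat_ge0 _ w2).
  by exists (k, l); rewrite /= -kE -lE; case: w aw {w1 w2 kE lE}.
have [a0|a0] := lerP 0 a; have [b0|b0] := lerP 0 b.
- by exists (a, b); split=> //; apply/eis_assocE; left; apply: Or31.
- exists (eis_rot (a, b)); split=> /=; [lia|lia|].
  by apply/eis_assocE; left; apply: Or32.
- exists (eis_opp (eis_rot (a, b))); split=> /=; [lia|lia|].
  by apply/eis_assocE; right; apply: Or32.
- exists (eis_opp (a, b)); split=> /=; [lia|lia|].
  by apply/eis_assocE; right; apply: Or31.
Qed.

(* Multiplication by 1 + 2 omega, a square root of -3. *)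
Definition eis_sqrtm3 (z : int * int) : int * int := eis_mul (1, 2) z.

Lemma eis_nm_sqrtm3 z : eis_nm (eis_sqrtm3 z) = 3 * eis_nm z.
Proof. by rewrite /eis_sqrtm3 eis_nm_mul. Qed.

Lemma eis_sqrtm3_inj : injective eis_sqrtm3.
Proof.
case=> a b [c d]; rewrite /eis_sqrtm3 /eis_mul /= => -[E1 E2].
by congr (_, _); lia.
Qed.

Lemma eis_sqrtm3_assoc z w : eis_assoc (eis_sqrtm3 z) (eis_sqrtm3 w) <-> eis_assoc z w.
Proof.
split=> -[u u1 E]; exists u => //; last by rewrite E /eis_sqrtm3 eis_mulA.
by apply: eis_sqrtm3_inj; rewrite E /eis_sqrtm3 eis_mulA.
Qed.

Lemma eis_sqrtm3_neq0 z : z != (0, 0) -> eis_sqrtm3 z != (0, 0).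
Proof. by apply: contra_neq => h; apply: eis_sqrtm3_inj; rewrite h. Qed.

Lemma eis_sqrtm3_div z : (3 %| z.1 + z.2)%Z -> exists w, z = eis_sqrtm3 w.
Proof.
case: z => a b /= /dvdz3P[k kE]; exists (a + 2 * (k - a), k - a).
by rewrite /eis_sqrtm3 /eis_mul /=; congr (_, _); lia.
Qed.

Lemma eis_sqrtm3_sum z : (3 %| (eis_sqrtm3 z).1 + (eis_sqrtm3 z).2)%Z.
Proof. by apply/dvdz3P; exists (z.1 - z.2); rewrite /eis_sqrtm3 /eis_mul /=; ring. Qed.

Lemma eis_assoc_sum z w : eis_assoc z w -> (3 %| z.1 + z.2)%Z -> (3 %| w.1 + w.2)%Z.
Proof.
case: z => a b /eis_assocE h /dvdz3P[k /= kE]; apply/dvdz3P.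
case: h => [[]|[]] -> /=; [exists k|exists (k - b)|exists (k - a)|exists (- k)
  |exists (b - k)|exists (a - k)]; lia.
Qed.

Lemma one_mod_sum z : one_mod_sqrtm3 z -> ~~ (3 %| z.1 + z.2)%Z.
Proof. by move=> /dvdz3P[k kE]; apply/negP => /dvdz3P[l lE]; lia. Qed.

Lemma one_mod_or z : ~~ (3 %| z.1 + z.2)%Z -> one_mod_sqrtm3 z \/ one_mod_sqrtm3 (eis_opp z).
Proof.
case: z => a b /= h; have E := divz_eq (a + b) 3; set q := (_ %/ _)%Z in E; set d := (_ %% _)%Z in E.
have d0 : 0 <= d by apply: modz_ge0.
have dlt3 : d < 3 by apply: ltz_pmod.
have [dE|[dE|dE]] : d = 0 \/ d = 1 \/ d = 2 by lia.
- by move/negP: h; case; apply/dvdz3P; exists q; lia.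
- by left; apply/dvdz3P; exists q => /=; lia.
- by right; apply/dvdz3P; exists (- q - 1) => /=; lia.
Qed.

(** The three opposites of powers of omega would change the residue 1 into -1. The three remaining
    associates match the three conjugates of an integer of trace 1. *)
Lemma one_mod_assoc z w : one_mod_sqrtm3 z -> one_mod_sqrtm3 w -> eis_assoc z w <->
  [\/ w = z, w = eis_rot z | w = eis_rot (eis_rot z)].
Proof.
case: z => a b /dvdz3P[k /= kE] /dvdz3P[l lE]; split=> [/eis_assocE[//|]|h].
  by case=> wE; exfalso; rewrite wE /= in lE; lia.
by apply/eis_assocE; left.
Qed.

(** * Splitting the zeta function at sqrt(-3) *)

Section DedekindSeries.
Variables (L : fieldExtType rat) (phi : {rmorphism L -> algC}) (r : L).
Hypothesis phir : phi r = sqrtC (-3).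
Hypothesis span : forall x, exists a b : rat, x = a%:A + b%:A * r.
Variables (R : realType) (s : R[i]).
Hypothesis s1 : 1 < complex.Re s.
Local Notation D := (@nonzero_ideals L).
Local Notation I := (eis_ideal r).
Local Notation g := (fun J : set L => dedekind_term s J).

Lemma dedekind_term_eis z : z != (0, 0) -> g (I z) = cpow (eis_nm z)%:~R (- s).
Proof. by move=> zN0; rewrite /dedekind_term -(ideal_norm_eis phir span zN0). Qed.

Let assocI z w : z != (0, 0) -> I z = I w <-> eis_assoc z w.
Proof. exact: eis_ideal_assoc phir span z w. Qed.

Lemma assoc_neq0 z w : z != (0, 0) -> eis_assoc z w -> w != (0, 0).
Proof.
move=> zN0 [u u1 ->]; have : eis_nm (eis_mul z u) = eis_nm z by rewrite eis_nm_mul u1 mulr1.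
by have := eis_nm_gt0 zN0; move=> /[swap] <-; apply: contraTneq => ->.
Qed.

(** One generator per ideal embeds the nonzero ideals into pairs of natural numbers, where
    convergence is known; the same choice is used to multiply ideals by sqrt(-3). *)
Lemma ideal_sector_generator : exists rep : set L -> nat * nat, forall J, D J ->
  rep J != (0%N, 0%N) /\ I ((rep J).1%:Z, (rep J).2%:Z) = J.
Proof.
have /choice[rep repP] J : exists x : nat * nat, D J ->
    x != (0%N, 0%N) /\ I (x.1%:Z, x.2%:Z) = J.
  have [DJ|nDJ] := pselect (D J); last by exists (0%N, 0%N).
  have [z zN0 JE] := ideal_principal phir span DJ.
  have [x xz] := eis_assoc_sector z; exists x => _.
  have xN0 := assoc_neq0 zN0 xz.
  by split; [apply: contraNneq xN0 => ->|rewrite JE; apply/esym/assocI].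
by exists rep.
Qed.

Lemma dedekind_abs_summable : abs_summable D g.
Proof.
have [rep repP] := ideal_sector_generator.
pose f0 (x : nat * nat) : R[i] := cpow (eis_nm (x.1%:Z, x.2%:Z))%:~R (- s).
have bij : set_bij D (rep @` D) rep.
  split=> [J DJ|J J' /set_mem DJ /set_mem DJ' E|x [J DJ <-]]; [by exists J| |by exists J].
  by rewrite -(repP _ DJ).2 -(repP _ DJ').2 E.
have sW : abs_summable (rep @` D) f0.
  apply: (@abs_summable_sub _ _ _ [set x : nat * nat | x != (0%N, 0%N)]).
    by move=> _ [J DJ <-]; exact: (repP _ DJ).1.
  exact: (@eis_abs_summable R _ s1 s erefl).
have := (abs_summable_reindex f0 bij).2 sW; apply: eq_abs_summable => J DJ.
have [xN0 {2}<-] := repP _ DJ; rewrite dedekind_term_eis//.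
Qed.

Definition coprime_ideals : set (set L) := [set J | exists2 z, one_mod_sqrtm3 z & J = I z].
Definition sqrtm3_ideals : set (set L) := [set J | exists2 z, z != (0, 0) & J = I (eis_sqrtm3 z)].
Local Notation A := coprime_ideals.
Local Notation B := sqrtm3_ideals.

Lemma one_mod_neq0 z : one_mod_sqrtm3 z -> z != (0, 0).
Proof. by move=> /one_mod_sum; apply: contraNneq => ->. Qed.

Lemma nonzero_ideals_split : D = A `|` B.
Proof.
rewrite predeqE => J; split=> [/(ideal_principal phir span)[z zN0 ->]|].
  have [h|h] := boolP (3 %| z.1 + z.2)%Z.
    have [w wE] := eis_sqrtm3_div h; right; exists w; last by rewrite wE.
    by apply: contraNneq zN0 => w0; rewrite wE w0.
  left; have [hz|hz] := one_mod_or h; first by exists z.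
  exists (eis_opp z) => //; apply/assocI => //.
  by apply/eis_assocE; right; apply: Or31.
case=> -[z hz ->]; apply: (eis_ideal_nonzero phir); first exact: one_mod_neq0.
exact: eis_sqrtm3_neq0.
Qed.

Lemma coprime_sqrtm3_disjoint : A `&` B = set0.
Proof.
rewrite predeqE => J; split=> // -[[z hz ->] [w wN0]].
move=> /(assocI _ (one_mod_neq0 hz))/eis_assoc_sym/eis_assoc_sum/(_ (eis_sqrtm3_sum w)) h.
by have := one_mod_sum hz; rewrite h.
Qed.

(** Multiplication by sqrt(-3) maps all nonzero ideals bijectively onto these and multiplies norms
    by 3. *)
Lemma sqrtm3_ideals_sum : csum B g = cpow 3 (- s) * csum D g.
Proof.
have [rep repP] := ideal_sector_generator.
pose zr J : int * int := ((rep J).1%:Z, (rep J).2%:Z).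
have zrN0 J : D J -> zr J != (0, 0).
  by move=> /repP[xN0 _]; apply: contraNneq xN0; rewrite /zr; case: (rep J) => a b /= [-> ->].
have zrI J : D J -> I (zr J) = J by move=> /repP[].
pose k J := I (eis_sqrtm3 (zr J)).
have kbij : set_bij D B k.
  split=> [J DJ|J J' /set_mem DJ /set_mem DJ'|_ [z zN0 ->]].
  - by exists (zr J) => //; apply: zrN0.
  - rewrite /k => /(assocI _ (eis_sqrtm3_neq0 (zrN0 _ DJ))).
    by move=> /eis_sqrtm3_assoc/(assocI _ (zrN0 _ DJ)); rewrite !zrI.
  - have Dz : D (I z) by exact: eis_ideal_nonzero phir _ zN0.
    exists (I z) => //; apply/esym/assocI; first exact: eis_sqrtm3_neq0.
    by apply/eis_sqrtm3_assoc/assocI => //; rewrite zrI.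
have sB : abs_summable B g.
  apply: (abs_summable_sub _ dedekind_abs_summable).
  by rewrite nonzero_ideals_split; exact: subsetUr.
rewrite -(csum_reindex kbij sB) -csumZ; last exact: dedekind_abs_summable.
apply: eq_csum => J DJ; have zN0 := zrN0 _ DJ.
have n0 := eis_nm_gt0 zN0.
rewrite /= /k -/(g _) dedekind_term_eis ?eis_sqrtm3_neq0// eis_nm_sqrtm3.
by rewrite -{2}(zrI _ DJ) -/(g _) dedekind_term_eis// intrM cpowM// ltr0z.
Qed.

Lemma coprime_ideals_sum : csum A g = (1 - cpow 3 (- s)) * dedekind_zeta L s.
Proof.
have zE : dedekind_zeta L s = csum A g + csum B g.
  have sAB := dedekind_abs_summable; rewrite nonzero_ideals_split in sAB.
  by rewrite -(csumU coprime_sqrtm3_disjoint sAB) -nonzero_ideals_split.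
by rewrite mulrBl mul1r -sqrtm3_ideals_sum [X in X - _]zE addrK.
Qed.
End DedekindSeries.

Theorem mainTheorem1 (R : realType) (K : splittingFieldType rat)
    (cubicK : abelian_cubic K) (tameK : tamely_ramified K) :
  (forall f : {poly int}, trace_one_cubics K f -> f`_1 <= 0) /\
  (forall s : R[i], 1 < complex.Re s ->
    [/\ abs_summable (trace_one_cubics K) (fun f => cpow (H R f) (- (2 * s))),
        abs_summable (@nonzero_ideals Qsqrtm3) (fun I => dedekind_term s I)
      & cpow (Num.sqrt (discriminant K)%:~R) s *
          csum (trace_one_cubics K) (fun f => cpow (H R f) (- (2 * s)))
        = (1 - cpow 3 (- s)) * dedekind_zeta Qsqrtm3 s]).
Proof.
split=> [f|s s1].
  have [t [t3 tfix _ _]] := abelian_cubic_generator cubicK.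
  exact: cubic_coef1_le0 t3 tfix f.
have [phi [r [phir span]]] := Qsqrtm3_generator.
have [N [N0 discE] [F [FD Fsurj Fker FN]]] := trace_one_cubics_param cubicK tameK.
set A := coprime_ideals r.
pose g (J : set Qsqrtm3) := dedekind_term s J.
have sD := dedekind_abs_summable phir span s1.
have sA : abs_summable A g.
  by apply: (abs_summable_sub _ sD); rewrite (nonzero_ideals_split phir span); exact: subsetUl.
have /choice[z zP] f : exists z, trace_one_cubics K f -> one_mod_sqrtm3 z /\ F z = f.
  have [fD|] := pselect (trace_one_cubics K f); last by exists (0, 0).
  by have [z hz zf] := Fsurj f fD; exists z.
(* [z f] is determined by f up to powers of omega, which do not affect the ideal; conversely the
   generators of this ideal congruent to 1 are exactly these multiples, so h is injective. *)
pose h f := eis_ideal r (z f).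
have assocI u v : one_mod_sqrtm3 u -> one_mod_sqrtm3 v ->
    eis_ideal r u = eis_ideal r v <-> F u = F v.
  move=> hu hv; rewrite (Fker u v hu hv) -one_mod_assoc//.
  exact: (eis_ideal_assoc phir span _ (one_mod_neq0 hu)).
have hbij : set_bij (trace_one_cubics K) A h.
  split=> [f /zP[hz _]|f f' /set_mem/zP[hz zf] /set_mem/zP[hz' zf']|_ [u hu ->]].
  - by exists (z f).
  - by move=> /(assocI _ _ hz hz'); rewrite zf zf'.
  - have [hz zf] := zP _ (FD u hu); exists (F u); first exact: FD.
    exact/assocI.
have NR : 0 < N%:R :> R by rewrite ltr0n.
(* H(f)^2 is N times the norm of [z f], and D_K = N^2; the factor N^(-s) taken out of every term
   cancels sqrt(D_K)^s. *)
have HE f : trace_one_cubics K f ->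
    cpow (H R f) (- (2 * s)) = cpow N%:R (- s) * (g \o h) f.
  move=> /zP[hz zf]; have zN0 := one_mod_neq0 hz; have n0 := eis_nm_gt0 zN0.
  have := FN _ hz; rewrite zf => E.
  have HE : H R f = Num.sqrt ((eis_nm (z f))%:~R * N%:R).
    rewrite /H; congr Num.sqrt; transitivity ((1 - 3 * f`_1)%:~R : R); first by ring.
    by rewrite E intrM.
  rewrite HE cpow_sqrt ?mulr_gt0 ?ltr0z// cpowM ?ltr0z//= mulrC.
  by rewrite -(dedekind_term_eis phir span).
have sh : abs_summable (trace_one_cubics K) (g \o h) by apply/(abs_summable_reindex g hbij).
split=> //.
- apply: (@eq_abs_summable _ _ _ (fun f => cpow N%:R (- s) * (g \o h) f)).
    by move=> f /HE.
  exact: abs_summableZ.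
- rewrite (eq_csum HE) csumZ// (csum_reindex hbij sA) mulrA discE.
  have -> : Num.sqrt ((N ^ 2)%:Z%:~R : R) = N%:R.
    by rewrite -pmulrn natrX sqrtr_sqr ger0_norm.
  by rewrite cpowN mul1r (coprime_ideals_sum phir span s1).
Qed.
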